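(* For every real number $\eta>0$ there exist a real number $\beta>0$ and a constant $C\geq 0$, both depending only on $\eta$, such that the following holds. Let $p$ be a prime number, let $X$ be an $\mathbf{F}_p$-valued random variable, let $Y=X_1-X_2$ be a stepping of $X$ and let $\widehat{Y}$ be a peaking of $X$. Then $$ \mathbf{E}\bigl(|\varphi_X(X\widehat{Y})|^2\bigr)\leq C\Bigl( \rho_X(0)+\rho_Y(0)^{\beta}+\frac{p^{-1+\eta}}{\rho_Y(0)}\Bigr). $$
   Context: $\mathbf{F}_p=\mathbf{Z}/p\mathbf{Z}$, and $e(z)=e^{2i\pi z}$. For an $\mathbf{F}_p$-valued random variable $Z$, write $\rho_Z(x)=\mathbf{P}(Z=x)$ for $x\in\mathbf{F}_p$, and $\varphi_Z(a)=\mathbf{E}(e(aZ/p))$ for $a\in\mathbf{F}_p$. A stepping of $X$ is a random variable $Y=X_1-X_2$ where $(X,X_1,X_2)$ are independent and identically distributed; then $\varphi_Y=|\varphi_X|^2$. A peaking of $X$ is an $\mathbf{F}_p$-valued random variable $\widehat{Y}$, independent of $(X,X_1,X_2)$, with $$\mathbf{P}(\widehat{Y}=a)=\frac{|\varphi_X(a)|^2}{M_X}\quad (a\in\mathbf{F}_p),\qquad M_X=\sum_{a\in\mathbf{F}_p}|\varphi_X(a)|^2 .$$ In the claim, $X\widehat{Y}$ is the product in $\mathbf{F}_p$ of the independent random variables $X$ and $\widehat{Y}$, and $\varphi_X(X\widehat{Y})$ is the (deterministic) function $\varphi_X$ evaluated at this random element. *)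

(* Defs.v *)
From HB Require Import structures.
From mathcomp Require Import all_boot all_order all_algebra.
From mathcomp Require Import all_classical all_reals all_analysis.
From mathcomp Require Import complex.
Set Implicit Arguments.
Unset Strict Implicit.
Unset Printing Implicit Defensive.
Import Order.TTheory GRing.Theory Num.Theory.
Import numFieldNormedType.Exports.
Local Open Scope classical_set_scope.
Local Open Scope ring_scope.
Local Open Scope complex_scope.

                                                                         
                                                                 
HB.instance Definition _ (n : nat) := isPointed.Build 'I_n.+1 ord0.
#[warnings="-redundant-canonical-projection"]
HB.instance Definition _ (n : nat) := @isMeasurable.Build
  default_measure_display 'I_n.+1 (@discrete_measurable 'I_n.+1)
  (@discrete_measurable0 _) (@discrete_measurableC _) (@discrete_measurableU _).

Section Independence.
Context d (T : measurableType d) (R : realType) (P : probability T R).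

Definition independent2 d1 (E1 : measurableType d1) d2 (E2 : measurableType d2)
    (U : T -> E1) (V : T -> E2) : Prop :=
  forall (A : set E1) (B : set E2), measurable A -> measurable B ->
    (P (U @^-1` A `&` V @^-1` B) = P (U @^-1` A) * P (V @^-1` B))%E.

Definition independent3 d' (E : measurableType d') (U V W : T -> E) : Prop :=
  forall A B C : set E, measurable A -> measurable B -> measurable C ->
    (P (U @^-1` A `&` V @^-1` B `&` W @^-1` C)
     = P (U @^-1` A) * P (V @^-1` B) * P (W @^-1` C))%E.

End Independence.

Section FpRandomVariables.
Context d (T : measurableType d) (R : realType) (P : probability T R).

Definition Cexpectation (f : T -> R[i]) : R[i] :=
  fine 'E_P[fun t => complex.Re (f t)] +i* fine 'E_P[fun t => complex.Im (f t)].

                                     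
Definition e (x : R) : R[i] := cos (2 * pi * x) +i* sin (2 * pi * x).

Definition rho (p : nat) (Z : {RV P >-> 'F_p}) (x : 'F_p) : R :=
  fine (P (Z @^-1` [set x])).

                                                                       
                                                                         
Definition phi (p : nat) (Z : {RV P >-> 'F_p}) (a : 'F_p) : R[i] :=
  Cexpectation (fun t => e ((a * Z t : 'F_p)%R%:R / p%:R)).

Definition normsq_phi (p : nat) (Z : {RV P >-> 'F_p}) (a : 'F_p) : R :=
  Normc.normc (phi Z a) ^+ 2.

Definition M (p : nat) (X : {RV P >-> 'F_p}) : R :=
  \sum_(a : 'F_p) normsq_phi X a.

Definition is_stepping (p : nat) (X X1 X2 Y : {RV P >-> 'F_p}) : Prop :=
  [/\ independent3 P X X1 X2,
      distribution P X1 = distribution P X,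
      distribution P X2 = distribution P X &
      forall t, Y t = X1 t - X2 t].

Definition is_peaking (p : nat) (X X1 X2 Yhat : {RV P >-> 'F_p}) : Prop :=
  independent2 P Yhat (fun t => (X t, X1 t, X2 t)) /\
  forall a : 'F_p, P (Yhat @^-1` [set a]) = (normsq_phi X a / M X)%:E.

End FpRandomVariables.

(* Main.v *)
Require Import Defs.
From HB Require Import structures.
From mathcomp Require Import all_boot all_order all_algebra.
From mathcomp Require Import all_classical all_reals all_analysis.
From mathcomp Require Import complex ring lra.
Set Implicit Arguments.
Unset Strict Implicit.
Unset Printing Implicit Defensive.
Import Order.TTheory GRing.Theory Num.Theory.
Import numFieldNormedType.Exports.
Local Open Scope ring_scope.

(** Let mu be the law of X and delta = sum mu(u)^2 = rho_Y(0).  Parseval's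
    identity turns the expectation into the mu-average of energy(x) / delta,
    where energy(x) is the probability that U - xV = U' - xV' for independent
    U, V, U', V' of law mu; this measures the additive coincidences between mu
    and its dilate by x ([peaking_expectation]).  The point x = 0 contributes
    exactly rho_X(0).  Call kappa the contribution of the other x.  The heart of
    the matter is an estimate with absolute constants,
    (kappa / 32)^k <= delta + 1 / (p delta)  ([average_energy_bound]).
    If delta >= p^(-1 + eta), the right-hand side is at most twice
    delta^min(1, eta), which gives the term rho_Y(0)^beta; otherwise
    p^(-1 + eta) / delta already exceeds 1, while kappa <= 1.

    The estimate on kappa is a sum-product phenomenon.  Let K stand for a power
    of 1 / kappa, not always the same.  Discarding the values of mu that are much
    larger or much smaller than delta leaves a set A of about 1 / delta elements
    ([mid_level]), and at least |A| / K dilations x for which A and xA have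
    additive energy at least |A|^3 / K.  The Balog-Szemeredi-Gowers theorem
    produces for each such x large pieces of A and xA with small difference
    sets; since all these pieces live in A, a pigeonhole argument and Ruzsa's
    triangle inequality replace them by a single set B, with
    |B - tB| <= K |B| for all t in a set T with |T| >= |A| / K
    ([common_dilation_set]).

    Call t tame when |B - tB| <= K |B|.  Tame elements are closed under the
    field operations, up to worsening K polynomially ([tame_add], [tame_mul],
    [tame_inv], [tame_opp]); for sums this is where Petridis's lemma enters.  On
    the other hand there are at most about K |B| of them once |B| exceeds K, because the energies of
    B with its dilates add up to at most |B|^4 plus a diagonal term
    ([card_tame_le]).  Now consider the quotients (a - b) / (c - d) of
    differences of elements of T.  Either they fill the prime field, and all p
    elements are tame, or some quotient r is such that 1 + r is not a quotient;
    then the elements s + s' (1 + r), with s and s' in T, are pairwise distinct,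
    and there are |T|^2 tame elements ([tame_spread]).  So |B| is at most K, or p
    or |T|^2 is at most K |B|; in each case the required bound on kappa follows,
    because |B| and |T| are about 1 / delta up to factors K. *)

(** * Sumsets: Ruzsa's triangle inequality and Petridis's lemma *)

Lemma eq_ler (R : numDomainType) (x y : R) : x = y -> x <= y.
Proof. by move=> ->. Qed.

Section Sumsets.
Import boot.fintype boot.finset.
Variable V : finZmodType.
Implicit Types (A B C X Z U W : {set V}).

Definition sumset A B : {set V} := [set a + b | a in A, b in B]%SET.
Definition diffset A B : {set V} := [set a - b | a in A, b in B]%SET.

Lemma sumset_f A B a b : a \in A -> b \in B -> a + b \in sumset A B.
Proof. by move=> aA bB; apply/imset2P; exists a b. Qed.

Lemma diffset_f A B a b : a \in A -> b \in B -> a - b \in diffset A B.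
Proof. by move=> aA bB; apply/imset2P; exists a b. Qed.

Lemma sumsetC A B : sumset A B = sumset B A.
Proof.
by apply/setP => x; apply/imset2P/imset2P => -[a b aA bB ->]; exists b a => //;
  rewrite addrC.
Qed.

Lemma diffsetS A A' B B' :
  A \subset A' -> B \subset B' -> diffset A B \subset diffset A' B'.
Proof. by move=> sA sB; apply: imset2S. Qed.

Lemma card_diffsetC A B : #|diffset A B| = #|diffset B A|.
Proof.
have -> : diffset A B = [set - x | x in diffset B A]%SET.
  apply/setP => x; apply/imset2P/imsetP => [[a b aA bB ->]|[y]].
    by exists (b - a); rewrite ?diffset_f // opprB.
  by case/imset2P => b a bB aA -> ->; exists a b => //; rewrite opprB.
by rewrite card_imset //; apply: oppr_inj.
Qed.

(** Write each d in A - B once and for all as a - b.  Then (u, d) is recovered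
    from the pair (a - u, u - b), whose sum is d. *)
Lemma ruzsa_triangle U A B :
  (#|U| * #|diffset A B| <= #|diffset A U| * #|diffset U B|)%N.
Proof.
pose rep d := odflt (0, 0) [pick u : V * V |
  [&& u.1 \in A, u.2 \in B & d == u.1 - u.2]].
have repP d : d \in diffset A B ->
    [/\ (rep d).1 \in A, (rep d).2 \in B & d = (rep d).1 - (rep d).2].
  rewrite /rep => /imset2P[a b aA bB dE]; case: pickP => [u /and3P[-> -> /eqP//]|].
  by move=> /(_ (a, b)); rewrite /= aA bB dE eqxx.
rewrite -!cardsX.
pose f (w : V * V) := ((rep w.2).1 - w.1, w.1 - (rep w.2).2).
rewrite -(@card_in_imset _ _ f).
  apply: subset_leq_card; apply/subsetP => _ /imsetP[[u d] + ->].
  rewrite !inE /= => /andP[uU /repP[aA bB _]].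
  by rewrite !diffset_f.
move=> [u d] [u' d']; rewrite !inE /= => /andP[_ /repP[_ _ dE]].
move=> /andP[_ /repP[_ _ dE']] [e1 e2].
have dd : d = d'.
  rewrite dE dE' -[LHS](subrKA u) -[RHS](subrKA u').
  by rewrite e1 e2.
by move: e1; rewrite dd => /addrI/oppr_inj ->.
Qed.


(** X is chosen among the nonempty subsets of A so that |X + C| / |X| is
    minimal.  The last inequality is proved by adding the elements of Z one at a
    time: if X1 is the set of x in X such that x + z already lies in X + Z, the
    new element z adds |X| - |X1| elements to X + Z and at most
    |X + C| - |X1 + C| elements to X + C + Z, and minimality compares X1 with X. *)
Lemma petridis A C : A != set0 -> exists X, [/\ X \subset A, X != set0,
    (#|sumset X C| * #|A| <= #|sumset A C| * #|X|)%N &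
    forall Z, (#|sumset (sumset X C) Z| * #|X| <= #|sumset X C| * #|sumset X Z|)%N].
Proof.
move=> A0.
have P0 : (A \subset A) && (A != set0) by rewrite fintype.subxx A0.
pose ratio X : rat := #|sumset X C|%:R / #|X|%:R.
case: (@Order.TotalTheory.arg_minP _ _ _ A
         (fun X : {set V} => (X \subset A) && (X != set0)) ratio P0).
move=> X /andP[XA X0] minX.
have card_gt0 (Y : {set V}) : Y != set0 -> (0 : rat) < #|Y|%:R by rewrite ltr0n finset.card_gt0.
have minXn (Y : {set V}) : Y \subset A -> (#|sumset X C| * #|Y| <= #|sumset Y C| * #|X|)%N.
  move=> YA; have [->|Y0] := eqVneq Y set0; first by rewrite cards0 muln0.
  have := minX Y; rewrite YA Y0 => /(_ isT).
  rewrite /ratio ler_pdivrMr ?card_gt0// mulrAC ler_pdivlMr ?card_gt0//.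
  by rewrite -!natrM ler_nat.
exists X; split => //; first exact: minXn.
move=> Z; suff H (s : seq V) : (#|sumset (sumset X C) [set x in s]| * #|X| <=
    #|sumset X C| * #|sumset X [set x in s]|)%N.
  by have := H (enum Z); rewrite set_enum.
elim: s => [|z s].
  rewrite set_nil (_ : sumset _ set0 = set0) ?cards0 //.
  by apply/eqP; rewrite -subset0; apply/subsetP => y /imset2P[u v _]; rewrite inE.
rewrite set_cons; move: [set x in s] => {s} Z IH.
pose X1 := [set x in X | x + z \in sumset X Z].
pose tr (B : {set V}) := [set b + z | b in B].
have card_tr B : #|tr B| = #|B| by apply: card_imset; apply: addIr.
have X0X : X1 \subset X by apply/subsetP => x; rewrite inE => /andP[].
have cXZ : #|sumset X (z |: Z)| = (#|sumset X Z| + (#|X| - #|X1|))%N.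
  have -> : sumset X (z |: Z) = sumset X Z :|: tr (X :\: X1).
    apply/setP => y; rewrite in_setU; apply/imset2P/orP.
      case=> x z' xX /setU1P[->|z'Z] ->; last by left; rewrite sumset_f.
      have [|xz] := boolP (x + z \in sumset X Z); first by left.
      by right; apply: imset_f; rewrite !inE xX (negbTE xz).
    case=> [/imset2P[x z' xX z'Z ->]|/imsetP[x]].
      by exists x z' => //; apply: setU1r.
    by rewrite !inE => /andP[_ xX] ->; exists x z => //; rewrite setU11.
  rewrite cardsU; have -> : sumset X Z :&: tr (X :\: X1) = set0.
    apply/eqP; rewrite -subset0; apply/subsetP => y; rewrite in_setI.
    case/andP => yXZ /imsetP[x]; rewrite !inE => /andP[+ xX] yE.
    by rewrite xX /= -yE yXZ.
  by rewrite cards0 subn0 card_tr cardsD (setIidPr X0X).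
have cXCZ : (#|sumset (sumset X C) (z |: Z)| <=
    #|sumset (sumset X C) Z| + (#|sumset X C| - #|sumset X1 C|))%N.
  have X0C : sumset X1 C \subset sumset X C by apply: imset2S.
  have /subset_leq_card H : sumset (sumset X C) (z |: Z) \subset
      sumset (sumset X C) Z :|: tr (sumset X C :\: sumset X1 C).
    apply/subsetP => y /imset2P[w z' wXC /setU1P[->|z'Z] ->]; last first.
      by rewrite in_setU sumset_f.
    rewrite in_setU.
    have [/imset2P[x c]|wX0] := boolP (w \in sumset X1 C); last first.
      by apply/orP; right; apply: imset_f; rewrite in_setD wX0.
    rewrite inE => /andP[xX /imset2P[x' z'' x'X z''Z xz]] cC ->.
    apply/orP; left; rewrite addrAC xz addrAC.
    by rewrite sumset_f // sumset_f.
  apply: (leq_trans H); rewrite cardsU card_tr cardsD (setIidPr X0C).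
  exact: leq_subr.
have le1 := minXn _ (subset_trans X0X XA).
have lXX0 := subset_leq_card X0X.
have lX0C : (#|sumset X1 C| <= #|sumset X C|)%N by apply/subset_leq_card/imset2S.
rewrite cXZ mulnDr; apply: (@leq_trans (#|sumset (sumset X C) Z| * #|X| +
   (#|sumset X C| - #|sumset X1 C|) * #|X|)).
  by rewrite -mulnDl leq_mul2r cXCZ orbT.
by apply: leq_add => //; rewrite mulnBl mulnBr leq_sub2l.
Qed.
End Sumsets.

(** * The dilations that a set tolerates *)

Section Dilates.
Import boot.fintype boot.finset.
Variables (F : finFieldType) (R : realFieldType).
Implicit Types (A B C X Z : {set F}) (s t : F) (L : R).

Definition dilate t B : {set F} := [set t * b | b in B].

Lemma dilate_f t B b : b \in B -> t * b \in dilate t B.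
Proof. exact: imset_f. Qed.

Lemma dilateM s t B : dilate s (dilate t B) = dilate (s * t) B.
Proof. by rewrite /dilate -imset_comp; apply: eq_imset => b /=; rewrite mulrA. Qed.

Lemma dilate1 B : dilate 1 B = B.
Proof. by rewrite /dilate (eq_imset _ (@mul1r _)) imset_id. Qed.

Lemma card_dilate t B : t != 0 -> #|dilate t B| = #|B|.
Proof. by move=> t0; apply/card_imset/mulfI. Qed.

Lemma dilate_sumset t A B : dilate t (sumset A B) = sumset (dilate t A) (dilate t B).
Proof.
apply/setP => x; apply/imsetP/imset2P.
  move=> [_ /imset2P[a b aA bB ->] ->].
  by exists (t * a) (t * b); rewrite ?dilate_f // mulrDr.
move=> [_ _ /imsetP[a aA ->] /imsetP[b bB ->] ->].
by exists (a + b); rewrite ?sumset_f // mulrDr.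
Qed.

Lemma diffsetE A B : diffset A B = sumset A (dilate (-1) B).
Proof.
apply/setP => x; apply/imset2P/imset2P.
  by move=> [a b aA bB ->]; exists a (-1 * b); rewrite ?dilate_f // mulN1r.
by move=> [a _ aA /imsetP[b bB ->] ->]; exists a b => //; rewrite mulN1r.
Qed.

Lemma dilate_diffset t A B : dilate t (diffset A B) = diffset (dilate t A) (dilate t B).
Proof. by rewrite !diffsetE dilate_sumset !dilateM mulrN1 mulN1r. Qed.

Lemma diffset_dilate A t B : diffset A (dilate t B) = sumset A (dilate (- t) B).
Proof. by rewrite diffsetE dilateM mulN1r. Qed.

Lemma dilateD_sub s t B : dilate (s + t) B \subset sumset (dilate s B) (dilate t B).
Proof.
by apply/subsetP => _ /imsetP[b bB ->]; rewrite mulrDl sumset_f // dilate_f.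
Qed.

Lemma sumsetA A B C : sumset A (sumset B C) = sumset (sumset A B) C.
Proof.
apply/setP => x; apply/imset2P/imset2P.
  move=> [a _ aA /imset2P[b c bB cC ->] ->].
  by exists (a + b) c; rewrite ?sumset_f // addrA.
move=> [_ c /imset2P[a b aA bB ->] cC ->].
by exists a (b + c); rewrite ?sumset_f // addrA.
Qed.

Lemma leq_card_sumset A B : A != set0 -> (#|B| <= #|sumset A B|)%N.
Proof.
case/set0Pn => a aA; rewrite -(card_imset B (addrI a)).
by apply/subset_leq_card/subsetP => _ /imsetP[b bB ->]; apply: sumset_f.
Qed.

Definition tame B L t := #|diffset B (dilate t B)|%:R <= L * #|B|%:R.

Lemma tameW B L L' t : L <= L' -> tame B L t -> tame B L' t.
Proof. by move=> LL' /le_trans; apply; rewrite ler_wpM2r ?ler0n. Qed.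

Lemma tame0 B L : 1 <= L -> tame B L 0.
Proof.
move=> L1; rewrite /tame; apply: (@le_trans _ _ #|B|%:R).
  rewrite ler_nat; apply/subset_leq_card/subsetP.
  by move=> _ /imset2P[b _ bB /imsetP[c _ ->] ->]; rewrite mul0r subr0.
by rewrite ler_peMl ?ler0n.
Qed.

(** Both copies of B are compared with the dilate tB. *)
Lemma tame_self B L t : B != set0 -> t != 0 -> tame B L t -> tame B (L ^+ 2) 1.
Proof.
rewrite /tame dilate1 => B0 t0 H.
have b0 : 0 < #|B|%:R :> R by rewrite ltr0n card_gt0.
have := ruzsa_triangle (dilate t B) B B.
rewrite card_dilate // (card_diffsetC (dilate t B)) -(ler_nat R) !natrM => H'.
rewrite -(ler_pM2l b0); apply: (le_trans H').
apply: le_trans (ler_pM (ler0n _ _) (ler0n _ _) H H) _.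
by apply: eq_ler; ring.
Qed.

Lemma tame_inv B L t : tame B L t -> tame B L t^-1.
Proof.
have [->|t0] := eqVneq t 0; first by rewrite invr0.
rewrite /tame -(card_dilate (diffset B (dilate t^-1 B)) t0).
by rewrite dilate_diffset dilateM divff // dilate1 card_diffsetC.
Qed.

(** The set sB serves as an intermediate point between B and stB. *)
Lemma tame_mul B L L' s t : B != set0 -> 1 <= L -> 1 <= L' ->
  tame B L s -> tame B L' t -> tame B (L * L') (s * t).
Proof.
move=> B0 L1 L1' Hs Ht; have [->|s0] := eqVneq s 0.
  by rewrite mul0r; apply: tame0; rewrite mulr_ege1.
have b0 : 0 < #|B|%:R :> R by rewrite ltr0n card_gt0.
rewrite /tame; have := ruzsa_triangle (dilate s B) B (dilate (s * t) B).
rewrite card_dilate // -dilateM -dilate_diffset card_dilate //.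
rewrite -(ler_nat R) !natrM => H; rewrite -(ler_pM2l b0); apply: (le_trans H).
apply: le_trans (ler_pM (ler0n _ _) (ler0n _ _) Hs Ht) _.
by apply: eq_ler; ring.
Qed.

(** Petridis's lemma for the summand - sB.  It controls B - sB - tB only after
    one copy of B has been shrunk to a subset X; the lower bound on |X| is what
    allows [tame_add] to come back from X to B. *)
Lemma petridis_tame B L s L' t : B != set0 -> s != 0 -> 0 <= L -> tame B L s ->
  tame B L' t -> exists X, [/\ X \subset B, X != set0,
    #|B|%:R <= L * #|X|%:R &
    #|sumset (sumset X (dilate (- s) B)) (dilate (- t) B)|%:R <= L * L' * #|B|%:R].
Proof.
move=> B0 s0 L0 Hs Ht.
have [X [XB X0 minX]] := petridis (dilate (- s) B) B0.
move=> /(_ (dilate (- t) B)) HX.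
have b0 : 0 < #|B|%:R :> R by rewrite ltr0n card_gt0.
have x0 : 0 < #|X|%:R :> R by rewrite ltr0n card_gt0.
have y_le : #|sumset X (dilate (- s) B)|%:R <= L * #|X|%:R.
  move: minX; rewrite -(ler_nat R) !natrM -(diffset_dilate B) => minX.
  rewrite -(ler_pM2r b0); apply: (le_trans minX).
  by rewrite mulrAC ler_wpM2r //; exact: Hs.
exists X; split => //.
  apply: le_trans y_le; rewrite ler_nat -(@card_dilate (- s)) ?oppr_eq0 //.
  exact: leq_card_sumset.
rewrite -(ler_pM2r x0).
move: HX; rewrite -(ler_nat R) !natrM => /le_trans; apply.
have z_le : #|sumset X (dilate (- t) B)|%:R <= L' * #|B|%:R.
  apply: le_trans Ht; rewrite ler_nat diffset_dilate.
  exact/subset_leq_card/imset2S.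
apply: le_trans (ler_pM (ler0n _ _) (ler0n _ _) y_le z_le) _.
by apply: eq_ler; ring.
Qed.

(** The set - tB - B is contained, up to translation, in X - tB - B. *)
Lemma tame_opp B L L' t : B != set0 -> 1 <= L -> 1 <= L' ->
  tame B L 1 -> tame B L' t -> tame B (L' * L) (- t).
Proof.
move=> B0 L1 L1' H1 Ht; have [->|t0] := eqVneq t 0.
  by rewrite oppr0; apply: tame0; rewrite mulr_ege1.
have [X [_ X0 _]] := petridis_tame B0 t0 (le_trans ler01 L1') Ht H1.
apply: le_trans; rewrite ler_nat.
have N10 : (-1 : F) != 0 by rewrite oppr_eq0 oner_neq0.
rewrite diffset_dilate opprK -(card_dilate _ N10) dilate_sumset dilateM mulN1r.
by rewrite -sumsetA (sumsetC (dilate (- t) B)); apply: leq_card_sumset.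
Qed.

(** As (s + t)B lies in sB + tB, the set X - (s + t)B is small for the set X of
    [petridis_tame], and X is an intermediate point between B and (s + t)B. *)
Lemma tame_add B L L1 L2 s t : B != set0 -> 1 <= L -> 1 <= L1 -> 1 <= L2 ->
  tame B L 1 -> tame B L1 s -> tame B L2 t -> tame B (L * L1 ^+ 2 * L2) (s + t).
Proof.
move=> B0 L_1 L1_1 L2_1 H1 Hs Ht.
have L1_0 := le_trans ler01 L1_1; have L2_0 := le_trans ler01 L2_1.
have L0 := le_trans ler01 L_1.
have [->|s0] := eqVneq s 0.
  rewrite add0r; apply: tameW Ht; rewrite ler_peMl //.
  by rewrite mulr_ege1 // expr_ge1.
have [X [XB X0 bX]] := petridis_tame B0 s0 L1_0 Hs Ht.
set W := sumset _ (dilate (- t) B) => HW.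
have x0 : 0 < #|X|%:R :> R by rewrite ltr0n card_gt0.
have := ruzsa_triangle X B (dilate (s + t) B).
rewrite -(ler_nat R) !natrM => H.
rewrite /tame -(ler_pM2l x0); apply: (le_trans H).
have H2 : #|diffset X (dilate (s + t) B)|%:R <= L1 * L2 * #|B|%:R.
  apply: le_trans HW; rewrite ler_nat diffset_dilate opprD /W -sumsetA.
  by apply/subset_leq_card/imset2S => //; apply: dilateD_sub.
have H3 : #|diffset B X|%:R <= L * #|B|%:R.
  apply: le_trans H1; rewrite ler_nat dilate1.
  exact/subset_leq_card/diffsetS.
apply: le_trans (ler_pM (ler0n _ _) (ler0n _ _) H3 H2) _.
have -> : L * #|B|%:R * (L1 * L2 * #|B|%:R) = (L * L1 * L2 * #|B|%:R) * #|B|%:R.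
  by ring.
have -> : #|X|%:R * (L * L1 ^+ 2 * L2 * #|B|%:R) =
   (L * L1 * L2 * #|B|%:R) * (L1 * #|X|%:R) by ring.
by rewrite ler_wpM2l // !mulr_ge0.
Qed.

End Dilates.

(** * A sum-product dichotomy *)

Section Counting.
Import boot.fintype boot.finset.
Variable R : realFieldType.

Lemma cauchy_schwarz_sum (I : finType) (P : pred I) (f g : I -> R) :
  (\sum_(i | P i) f i * g i) ^+ 2 <=
  (\sum_(i | P i) f i ^+ 2) * (\sum_(i | P i) g i ^+ 2).
Proof.
have : 0 <= \sum_(i | P i) \sum_(j | P j) (f i * g j - f j * g i) ^+ 2.
  by apply: sumr_ge0 => i _; apply: sumr_ge0 => j _; apply: sqr_ge0.
have -> : \sum_(i | P i) \sum_(j | P j) (f i * g j - f j * g i) ^+ 2 =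
  2 * ((\sum_(i | P i) f i ^+ 2) * (\sum_(i | P i) g i ^+ 2) -
    (\sum_(i | P i) f i * g i) ^+ 2).
  transitivity (\sum_(i | P i) \sum_(j | P j)
      (f i ^+ 2 * g j ^+ 2 + f j ^+ 2 * g i ^+ 2 - 2 * ((f i * g i) * (f j * g j)))).
    by apply: eq_bigr => i _; apply: eq_bigr => j _; ring.
  under eq_bigr => i _.
    rewrite !big_split /= -mulr_sumr -mulr_suml sumrN -mulr_sumr -mulr_sumr.
    over.
  by rewrite !big_split /= -mulr_suml -mulr_sumr sumrN -mulr_sumr -mulr_suml; ring.
by rewrite pmulr_rge0 // subr_ge0.
Qed.

Lemma sqr_sum_le_card (I : finType) (P : {set I}) (f : I -> R) :
  (\sum_(i in P) f i) ^+ 2 <= #|P|%:R * \sum_(i in P) f i ^+ 2.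
Proof.
have := cauchy_schwarz_sum (mem P) (fun=> 1) f.
under eq_bigr do rewrite mul1r.
under [X in _ <= X * _ -> _]eq_bigr do rewrite expr1n.
by rewrite sumr_const.
Qed.

Lemma sum1_eq (J : finType) (D : {set J}) (x : J) :
  \sum_(d in D) (x == d)%:R = (x \in D)%:R :> R.
Proof.
have [xD|xD] := boolP (x \in D).
  rewrite (bigD1 x) //= eqxx big1 ?addr0 // => d /andP[_ /negbTE].
  by rewrite eq_sym => ->.
by rewrite big1 // => d dD; case: eqP => // xd; rewrite xd dD in xD.
Qed.

(** Cauchy-Schwarz on the sizes of the fibres of f: a map with few values has
    many collisions. *)
Lemma card_collisions (I J : finType) (A : {set I}) (f : I -> J) (D : {set J}) :
  {in A, forall i, f i \in D} ->
  #|A|%:R ^+ 2 <= #|D|%:R * \sum_(i in A) \sum_(j in A) (f i == f j)%:R :> R.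
Proof.
move=> fD.
have -> : #|A|%:R = \sum_(d in D) \sum_(i in A) (f i == d)%:R :> R.
  rewrite exchange_big /= -sumr_const; apply: eq_bigr => i iA.
  by rewrite sum1_eq fD.
apply: (le_trans (sqr_sum_le_card _ _)); rewrite ler_wpM2l ?ler0n //.
apply: eq_ler.
under eq_bigr => d _.
  rewrite expr2 mulr_suml; under eq_bigr do rewrite mulr_sumr.
  over.
rewrite exchange_big; apply: eq_bigr => i iA.
rewrite exchange_big; apply: eq_bigr => j jA /=.
have [->|ne] := eqVneq (f i) (f j).
  under eq_bigr => d _ do rewrite -natrM mulnb andbb.
  by rewrite sum1_eq fD.
rewrite big1 // => d _; case: eqP => [fid|_]; last by rewrite mul0r.
by case: eqP => [fjd|_]; [rewrite fid fjd eqxx in ne | rewrite mulr0].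
Qed.

Variable F : finFieldType.

(** By [card_collisions] every tame r yields at least |B|^3 / L solutions of
    a - r b = c - r d in B.  Summed over r there are few solutions, as a
    quadruple with (a, b) <> (c, d) determines r. *)
Lemma card_tame_le (B T : {set F}) (L : R) : 0 <= L -> B != set0 ->
  {in T, forall r, tame B L r} ->
  #|T|%:R * #|B|%:R <= L * (#|T|%:R + #|B|%:R ^+ 2).
Proof.
move=> L0 B0 tameT; pose BB := setX B B.
have b0 : 0 < #|B|%:R :> R by rewrite ltr0n card_gt0.
pose E r : R := \sum_(i in BB) \sum_(j in BB) (i.1 - r * i.2 == j.1 - r * j.2)%:R.
have cBB : #|BB|%:R = #|B|%:R ^+ 2 :> R by rewrite cardsX natrM expr2.
have E_ge r : r \in T -> #|B|%:R ^+ 4 <= L * #|B|%:R * E r.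
  move=> rT; have /card_collisions : {in BB, forall i, i.1 - r * i.2 \in diffset B (dilate r B)}.
    by move=> [a b]; rewrite !inE /= => /andP[aB bB]; rewrite diffset_f ?dilate_f.
  rewrite cBB -exprM => /le_trans; apply; rewrite ler_wpM2r //; last exact: tameT.
  by apply: sumr_ge0 => i _; apply: sumr_ge0 => j _; rewrite ler0n.
have E_le : \sum_(r in T) E r <= #|T|%:R * #|B|%:R ^+ 2 + #|B|%:R ^+ 4.
  rewrite exchange_big /=; under eq_bigr do rewrite exchange_big /=.
  apply: (@le_trans _ _ (\sum_(i in BB) \sum_(j in BB) (#|T|%:R * (i == j)%:R + 1))).
    apply: ler_sum => -[a b] _; apply: ler_sum => -[c d] _ /=.
    have [[-> ->]|ne] := eqVneq (a, b) (c, d).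
      rewrite (eq_bigr (fun=> 1)) ?sumr_const; last by move=> r _; rewrite eqxx.
      by rewrite mulr1 lerDl ler01.
    rewrite mulr0 add0r; have [bd|bd] := eqVneq b d.
      rewrite big1 ?ler01 // => r _; rewrite bd; case: eqP => // /addIr ac.
      by rewrite ac bd eqxx in ne.
    apply: (@le_trans _ _ (\sum_(r in T) ((a - c) / (b - d) == r)%:R)).
      apply: ler_sum => r _; rewrite ler_nat; case: eqP => // e.
      rewrite -[X in _ == X](mulfK (_ : b - d != 0)) ?subr_eq0 // lt0b.
      suff -> : r * (b - d) = a - c by [].
      have -> : a = c - r * d + r * b by rewrite -e subrK.
      by ring.
    by rewrite sum1_eq lern1; case: (_ \in _).
  under eq_bigr => i iB.
    rewrite big_split /= -mulr_sumr sum1_eq iB mulr1 sumr_const cBB.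
    over.
  by rewrite sumr_const -[leLHS]mulr_natr cBB; apply: eq_ler; ring.
have : #|T|%:R * #|B|%:R ^+ 4 <= L * #|B|%:R * (#|T|%:R * #|B|%:R ^+ 2 + #|B|%:R ^+ 4).
  apply: (@le_trans _ _ (L * #|B|%:R * \sum_(r in T) E r)); last first.
    by rewrite ler_wpM2l // mulr_ge0 // ltW.
  rewrite mulr_sumr mulr_natl -sumr_const; apply: ler_sum => r rT.
  exact: E_ge.
have -> : #|T|%:R * #|B|%:R ^+ 4 = (#|T|%:R * #|B|%:R) * #|B|%:R ^+ 3 :> R by ring.
have -> : L * #|B|%:R * (#|T|%:R * #|B|%:R ^+ 2 + #|B|%:R ^+ 4) =
  (L * (#|T|%:R + #|B|%:R ^+ 2)) * #|B|%:R ^+ 3 by ring.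
by rewrite ler_pM2r // exprn_gt0.
Qed.

End Counting.

Section SumProduct.
Import boot.fintype boot.finset.
Variables (R : realFieldType) (p : nat).
Hypothesis p_prime : prime p.

Lemma set_closed_succ (Q : {set 'F_p}) :
  0 \in Q -> {in Q, forall r, 1 + r \in Q} -> Q = setT.
Proof.
move=> Q0 Q1; apply/setP => x; rewrite in_setT -(natr_Zp x).
elim: (nat_of_ord x) => // n; rewrite mulrS; exact: Q1.
Qed.

(** Q is the set of quotients of differences of S.  It contains 0, so either it
    is the whole field or it is not stable under r |-> 1 + r.  In the second case
    s + s' (1 + r) = t + t' (1 + r) with s' <> t' would exhibit 1 + r as a
    quotient.  The exponent 17 adds up the losses of the field operations that
    build s + s' (1 + r) from elements of S. *)
Lemma tame_spread (S B : {set 'F_p}) (L : R) : S != set0 -> B != set0 -> 1 <= L ->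
  tame B L 1 -> {in S, forall s, tame B L s} ->
  exists2 T : {set 'F_p}, (minn p (#|S| ^ 2) <= #|T|)%N &
    {in T, forall u, tame B (L ^+ 17) u}.
Proof.
move=> /set0Pn[s0 s0S] B0 L1 tame1 tameS.
have Lk k : 1 <= L ^+ k by rewrite exprn_ege1.
have tameB s t : s \in S -> t \in S -> tame B (L ^+ 5) (s - t).
  move=> sS tS; apply: tameW (tame_add B0 L1 L1 (Lk 2) tame1 (tameS _ sS) _).
    by apply: eq_ler; ring.
  by apply: tameW (tame_opp B0 L1 L1 tame1 (tameS _ tS)); rewrite -expr2.
pose Q := [set ((w.1.1 - w.1.2) / (w.2.1 - w.2.2)) | w in setX (setX S S) (setX S S)].
have QP s1 s2 s3 s4 : s1 \in S -> s2 \in S -> s3 \in S -> s4 \in S ->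
    (s1 - s2) / (s3 - s4) \in Q.
  move=> h1 h2 h3 h4; apply/imsetP; exists ((s1, s2), (s3, s4)) => //.
  by rewrite !inE /= h1 h2 h3 h4.
have tameQ r : r \in Q -> tame B (L ^+ 10) r.
  case/imsetP => -[[s1 s2] [s3 s4]]; rewrite !inE /= -andbA.
  case/and4P => h1 h2 h3 h4 ->; rewrite (exprD _ 5 5).
  by apply: tame_mul => //; [apply: tameB | apply/tame_inv/tameB].
have [QT|QnT] := eqVneq Q setT.
  exists setT; first by rewrite cardsT card_Fp // geq_minl.
  move=> u _; apply: (@tameW _ _ _ (L ^+ 10)); last by apply: tameQ; rewrite QT inE.
  by rewrite ler_weXn2l.
have [r rQ r1Q] : exists2 r, r \in Q & 1 + r \notin Q.
  apply/exists_inP; apply: contraT; rewrite negb_exists_in => /forall_inP H.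
  case/eqP: QnT; apply: set_closed_succ.
    by have := QP _ _ _ _ s0S s0S s0S s0S; rewrite subrr mul0r.
  by move=> r /H; rewrite negbK.
exists [set w.1 + w.2 * (1 + r) | w in setX S S].
  rewrite card_in_imset; first by rewrite cardsX geq_minr.
  move=> [s s'] [t t']; rewrite !inE /= => /andP[sS s'S] /andP[tS t'S] e.
  have [s't'|ne] := eqVneq s' t'; first by move: e; rewrite s't' => /addIr ->.
  case/negP: r1Q; have -> : 1 + r = (t - s) / (s' - t'); last exact: QP.
  have ne0 : s' - t' != 0 by rewrite subr_eq0.
  apply: (mulIf ne0); rewrite divfK //.
  have -> : t = s + s' * (1 + r) - t' * (1 + r) by rewrite e addrK.
  by ring.
move=> _ /imsetP[[s s'] + ->]; rewrite !inE /= => /andP[sS s'S].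
have tame1r : tame B (L ^+ 13) (1 + r).
  apply: tameW (tame_add B0 L1 L1 (Lk 10) tame1 tame1 (tameQ _ rQ)).
  by apply: eq_ler; ring.
apply: tameW (tame_add B0 L1 L1 (Lk 14) tame1 (tameS _ sS) _).
  by apply: eq_ler; ring.
by rewrite exprS; apply: tame_mul => //; apply: tameS.
Qed.

(** The lower bound of [tame_spread] for the number of tame dilations against
    the upper bound of [card_tame_le].  The exponent is 34 = 2 * 17 because B - B
    is only controlled by L^2. *)
Lemma sum_product (S B : {set 'F_p}) (L : R) :
  S != set0 -> 0 \notin S -> B != set0 -> 1 <= L ->
  {in S, forall s, tame B L s} ->
  [\/ #|B|%:R <= 2 * L ^+ 34, p%:R <= 2 * L ^+ 34 * #|B|%:R |
      #|S|%:R ^+ 2 <= 2 * L ^+ 34 * #|B|%:R].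
Proof.
move=> S0 nS0 B0 L1 tameS; have [s sS] := set0Pn _ S0.
have L21 : 1 <= L ^+ 2 by rewrite exprn_ege1.
have sn0 : s != 0 by apply: contraNneq nS0 => <-.
have [] := tame_spread S0 B0 L21 (tame_self B0 sn0 (tameS _ sS)).
  move=> t tS; apply: tameW (tameS _ tS).
  by rewrite expr2 ler_peMl // (le_trans ler01).
move=> T cT; rewrite -exprM => tameT.
have L34 : 0 <= L ^+ 34 by rewrite exprn_ge0 // (le_trans ler01).
have := card_tame_le L34 B0 tameT; set M := L ^+ 34 in L34 *.
have b0 : 0 < #|B|%:R :> R by rewrite ltr0n card_gt0.
have [bM|bM] := leP #|B|%:R (2 * M); first by constructor 1.
move=> H; have TM : #|T|%:R <= 2 * M * #|B|%:R.
  rewrite -(ler_pM2r b0); have : M * #|T|%:R <= #|B|%:R * #|T|%:R / 2.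
    by have := ler_wpM2r (ler0n R #|T|) (ltW bM); lra.
  by move=> H'; nra.
have [pS|Sp] := leqP p (#|S| ^ 2).
  constructor 2; apply: le_trans TM; rewrite ler_nat.
  by rewrite (minn_idPl pS) in cT.
constructor 3; apply: le_trans TM; rewrite -natrX ler_nat.
by rewrite (minn_idPr (ltnW Sp)) in cT.
Qed.

End SumProduct.

(** * The Balog-Szemeredi-Gowers theorem *)

Section BalogSzemerediGowers.
Import boot.fintype boot.finset.
Variables (R : realFieldType) (V : finZmodType).
Implicit Types (A B D : {set V}).

(** The left summands of the representations of c as an element of A + B. *)
Definition fiber A B c : {set V} := [set a in A | c - a \in B].

Lemma sum_mem B : \sum_c (c \in B)%:R = #|B|%:R :> R.
Proof.
rewrite -sumr_const [RHS]big_mkcond; apply: eq_bigr => c _.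
by case: (c \in B).
Qed.

Lemma sum_mem_shift B a : \sum_c (c + a \in B)%:R = #|B|%:R :> R.
Proof. by rewrite -(reindex_inj (addIr a) (P := xpredT) (F := fun c => (c \in B)%:R)) sum_mem. Qed.

Definition reps B d : R := \sum_(b in B) (b + d \in B)%:R.

Lemma reps_ge0 B d : 0 <= reps B d.
Proof. by apply: sumr_ge0. Qed.

Lemma sum_reps B : \sum_d reps B d = #|B|%:R ^+ 2.
Proof.
rewrite exchange_big /=; under eq_bigr => b _.
  under eq_bigr do rewrite addrC. rewrite sum_mem_shift. over.
by rewrite sumr_const -[LHS]mulr_natr expr2.
Qed.

(** The number of fibers that contain both a and a' depends on B only. *)
Lemma reps_sub B a a' : \sum_c (c - a \in B)%:R * (c - a' \in B)%:R = reps B (a - a').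
Proof.
rewrite (reindex_inj (addIr a)) /reps [RHS]big_mkcond /=.
apply: eq_bigr => b _; rewrite addrK addrA.
by case: (b \in B); rewrite ?mul1r ?mul0r.
Qed.

Lemma card_fiber A B c : #|fiber A B c|%:R = \sum_(a in A) (c - a \in B)%:R :> R.
Proof.
rewrite -sum_mem [RHS]big_mkcond; apply: eq_bigr => a _; rewrite inE.
by case: (a \in A).
Qed.

Lemma sum_card_fiber A B : \sum_c #|fiber A B c|%:R = #|A|%:R * #|B|%:R :> R.
Proof.
under eq_bigr do rewrite card_fiber.
rewrite exchange_big /=; under eq_bigr do rewrite sum_mem_shift.
by rewrite sumr_const -[LHS]mulr_natl.
Qed.

Lemma sum_fiber A B c (f : V -> R) :
  \sum_(a in A) (c - a \in B)%:R * f a = \sum_(a in fiber A B c) f a.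
Proof.
rewrite big_mkcond [RHS]big_mkcond; apply: eq_bigr => a _; rewrite inE.
by case: (a \in A) => //=; case: (c - a \in B); rewrite ?mul1r ?mul0r.
Qed.

(** A pair (a, a') is bad when a - a' has at most N / (64 K) representations as
    a difference in B.  By [reps_sub] a bad pair lies in few fibers, so
    the fibers contain on average few bad pairs compared with the square of their
    size, whose sum is the energy.  The linear term in the auxiliary
    function g excludes small fibers. *)
Lemma exists_good_fiber A B (N K : R) : 0 < N -> 1 <= K ->
  #|A|%:R <= N -> #|B|%:R <= N ->
  N ^+ 3 <= K * \sum_c #|fiber A B c|%:R ^+ 2 ->
  exists c, [/\ N <= 4 * K * #|fiber A B c|%:R &
    16 * (\sum_(a in fiber A B c) \sum_(a' in fiber A B c)
       (reps B (a - a') <= N / (64 * K))%R%:R) <= #|fiber A B c|%:R ^+ 2 :> R].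
Proof.
move=> N0 K1 AN BN energy; have K0 : 0 < K by apply: lt_le_trans K1.
pose bad a a' : R := (reps B (a - a') <= N / (64 * K))%R%:R.
pose badc c := \sum_(a in fiber A B c) \sum_(a' in fiber A B c) bad a a'.
have badc_ge0 c : 0 <= badc c.
  by apply: sumr_ge0 => a _; apply: sumr_ge0 => a' _; apply: ler0n.
have sum_bad : \sum_c badc c <= N ^+ 3 / (64 * K).
  have -> : \sum_c badc c =
      \sum_(a in A) \sum_(a' in A) bad a a' * reps B (a - a').
    under [RHS]eq_bigr => a _.
      under eq_bigr => a' _ do rewrite -reps_sub mulr_sumr.
      rewrite exchange_big /=. over.
    rewrite exchange_big; apply: eq_bigr => c _ /=; rewrite /badc -sum_fiber.
    apply: eq_bigr => a aA; rewrite -sum_fiber mulr_sumr.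
    by apply: eq_bigr => a' _; ring.
  apply: (@le_trans _ _ (\sum_(a in A) \sum_(a' in A) N / (64 * K))).
    apply: ler_sum => a _; apply: ler_sum => a' _.
    rewrite /bad; case: (leP (reps B (a - a')) (N / (64 * K))) => [h|_]; first by rewrite mul1r.
    rewrite mul0r.
    by rewrite divr_ge0 ?mulr_ge0 // ltW.
  under eq_bigr do rewrite sumr_const -[_ *+ #|A|]mulr_natr.
  rewrite sumr_const -[_ *+ #|A|]mulr_natr -mulrA.
  have -> : N ^+ 3 / (64 * K) = N / (64 * K) * (N * N) by ring.
  by rewrite ler_wpM2l ?ler_pM // divr_ge0 ?mulr_ge0 // ltW.
pose g c : R := #|fiber A B c|%:R ^+ 2 - 16 * badc c - N / (4 * K) * #|fiber A B c|%:R.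
have sum_g : 0 < \sum_c g c.
  rewrite !big_split /= !sumrN -!mulr_sumr sum_card_fiber.
  have e1 : N ^+ 3 / K <= \sum_c #|fiber A B c|%:R ^+ 2.
    by rewrite ler_pdivrMr // mulrC.
  have e2 : N / (4 * K) * (#|A|%:R * #|B|%:R) <= N ^+ 3 / K / 4.
    have -> : N ^+ 3 / K / 4 = N / (4 * K) * (N * N) by field; rewrite gt_eqF.
    by rewrite ler_wpM2l ?ler_pM // divr_ge0 ?mulr_ge0 // ltW.
  have e3 : N ^+ 3 / (64 * K) = N ^+ 3 / K / 64 by field; rewrite gt_eqF.
  have e4 : 0 < N ^+ 3 / K by rewrite divr_gt0 // exprn_gt0.
  by rewrite e3 in sum_bad; lra.
have [c gc] : exists c, 0 < g c.
  apply/existsP; apply: contraT; rewrite negb_exists => /forallP H.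
  move: sum_g; rewrite ltNge sumr_le0 // => c _; by rewrite leNgt H.
exists c; have f0 : 0 <= #|fiber A B c|%:R :> R by [].
have NK0 : 0 < N / (4 * K) by rewrite divr_gt0 // mulr_gt0.
rewrite -/(badc c); move: gc (badc_ge0 c) f0; rewrite /g.
set f := #|fiber A B c|%:R; set b := badc c => gc b0 f0.
have fNK : N / (4 * K) < f.
  by rewrite -subr_gt0; apply: contraTT gc; rewrite -!leNgt => le0; nra.
split; last by nra.
by rewrite mulrC -ler_pdivrMr ?mulr_gt0 // ltW.
Qed.

(** In the fiber given by [exists_good_fiber], D collects the elements that form a
    bad pair with at most a quarter of the fiber.  Two elements a, a' of D then
    have half of the fiber as common good partners m, and
    a - a' = (a - m) - (a' - m) gets many representations by four elements of B.
    As there are only |B|^4 quadruples, D - D is small. *)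
Lemma balog_szemeredi_gowers A B (N K : R) : 0 < N -> 1 <= K ->
  #|A|%:R <= N -> #|B|%:R <= N ->
  N ^+ 3 <= K * \sum_c #|fiber A B c|%:R ^+ 2 ->
  exists c D, [/\ D \subset fiber A B c, N <= 8 * K * #|D|%:R &
    #|diffset D D|%:R <= 8 * 64 ^+ 2 * K ^+ 3 * N].
Proof.
move=> N0 K1 AN BN energy; have K0 : 0 < K by apply: lt_le_trans K1.
have [c [fN badN]] := exists_good_fiber N0 K1 AN BN energy.
set Fc := fiber A B c in fN badN; set f : R := #|Fc|%:R in fN badN.
pose g := N / (64 * K); rewrite -/g in badN.
have g0 : 0 < g by rewrite divr_gt0 // mulr_gt0.
pose bad a a' : R := (reps B (a - a') <= g)%R%:R.
pose nb a : R := \sum_(a' in Fc) bad a a'.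
have nb0 a : 0 <= nb a by apply: sumr_ge0.
pose D := [set a in Fc | 4 * nb a <= f].
have DF : D \subset Fc by apply/subsetP => a; rewrite inE => /andP[].
have f0 : 0 < f.
  have K4 : 0 < 4 * K by rewrite mulr_gt0.
  by rewrite -(pmulr_rgt0 _ K4); apply: lt_le_trans fN.
(* There are at most f^2 / 16 bad pairs, and more than f / 4 of them start at
   each element outside D. *)
have cD : #|Fc :\: D|%:R <= f / 4.
  have : #|Fc :\: D|%:R * (f / 4) <= \sum_(a in Fc) nb a.
    rewrite (big_setID D) /= -[leLHS]add0r lerD ?sumr_ge0 //.
    rewrite mulr_natl -sumr_const; apply: ler_sum => a.
    by rewrite !inE => /andP[+ aF]; rewrite aF /= -ltNge => /ltW; lra.
  by move=> H; rewrite -(ler_pM2r f0); move: badN; rewrite -/(nb _); nra.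
exists c, D; split => //.
  have : f <= 2 * #|D|%:R.
    have : f = #|D|%:R + #|Fc :\: D|%:R.
      by rewrite -natrD cardsD (setIidPr DF) subnKC // subset_leq_card.
    by lra.
  move=> fD; apply: (le_trans fN).
  have := ler_wpM2l (ltW K0) fD; lra.
pose Rep d := \sum_e reps B e * reps B (e - d).
have RepE a a' : \sum_m reps B (a - m) * reps B (a' - m) = Rep (a - a').
  rewrite /Rep [RHS](reindex_inj (inj_comp (addrI a) oppr_inj)) /=.
  apply: eq_bigr => m _; congr (_ * reps B _).
  by rewrite opprB [RHS]addrC addrA subrK.
have Rep_ge d : d \in diffset D D -> f / 2 * g ^+ 2 <= Rep d.
  move=> /imset2P[a a']; rewrite !inE => /andP[_ nba] /andP[_ nba'] ->.
  have : f / 2 <= \sum_(m in Fc) (1 - bad a m - bad a' m).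
    by rewrite !big_split /= !sumrN sumr_const -/f -!/(nb _); lra.
  move=> /(ler_wpM2r (sqr_ge0 g)) /le_trans; apply.
  rewrite -RepE mulr_suml [leLHS]big_mkcond /=; apply: ler_sum => m _.
  have rr0 : 0 <= reps B (a - m) * reps B (a' - m) by rewrite mulr_ge0 ?reps_ge0.
  case: (m \in Fc) => //; rewrite /bad.
  case: (leP (reps B (a - m)) g) => h1; case: (leP (reps B (a' - m)) g) => h2 /=;
    rewrite ?subr0 ?subrr ?sub0r ?mulNr ?mul1r ?mul0r //; try by apply: le_trans rr0; nra.
  by rewrite expr2; apply: ler_pM; rewrite ?ltW.
have sum_Rep : \sum_d Rep d <= N ^+ 4.
  rewrite exchange_big /=; under eq_bigr => e _.
    rewrite -mulr_sumr (reindex_inj (inj_comp (addrI e) oppr_inj)) /=.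
    under eq_bigr do rewrite opprB addrC subrK.
    rewrite sum_reps. over.
  by rewrite -mulr_suml sum_reps -expr2 -exprM ler_pXn2r ?nnegrE // ltW.
have : #|diffset D D|%:R * (f / 2 * g ^+ 2) <= N ^+ 4.
  apply: le_trans sum_Rep; rewrite mulr_natl -sumr_const.
  apply: (le_trans (ler_sum _ Rep_ge)).
  rewrite [leLHS]big_mkcond /=; apply: ler_sum => d _; case: ifP => // _.
  by apply: sumr_ge0 => e _; rewrite mulr_ge0 ?reps_ge0.
have low : N ^+ 3 / (8 * 64 ^+ 2 * K ^+ 3) <= f / 2 * g ^+ 2.
  have -> : N ^+ 3 / (8 * 64 ^+ 2 * K ^+ 3) = (N / (4 * K)) / 2 * g ^+ 2.
    have : 64 != 0 :> R by rewrite pnatr_eq0.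
    by rewrite /g; move: (64 : R) => w w0; field; rewrite w0 gt_eqF.
  rewrite ler_wpM2r ?sqr_ge0 // ler_wpM2r // ler_pdivrMr ?mulr_gt0 //.
  by rewrite mulrC.
move=> H; have := le_trans (ler_wpM2l (ler0n _ _) low) H.
rewrite mulrA ler_pdivrMr ?mulr_gt0 ?exprn_gt0 //.
have -> : N ^+ 4 * (8 * 64 ^+ 2 * K ^+ 3) = (8 * 64 ^+ 2 * K ^+ 3 * N) * N ^+ 3 by ring.
by rewrite ler_pM2r // exprn_gt0.
Qed.

End BalogSzemerediGowers.

(** * From many large energies to one set with many tame dilations *)

Section Pigeonhole.
Import boot.fintype boot.finset.
Variable R : realFieldType.

(** The average of |E x :&: E y| over x and y in S is at least r^2 M, by
    Cauchy-Schwarz applied to the number of sets E x through a point of U. *)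
Lemma popular_intersection (I J : finType) (S : {set I}) (U : {set J})
    (E : I -> {set J}) (M r : R) :
  S != set0 -> 0 < M -> 0 <= r -> #|U|%:R <= M ->
  {in S, forall x, E x \subset U} -> {in S, forall x, r * M <= #|E x|%:R} ->
  exists (x0 : I) (S' : {set I}), [/\ x0 \in S, S' \subset S, r ^+ 2 * #|S|%:R <= 2 * #|S'|%:R &
    {in S', forall x, r ^+ 2 * M <= 2 * #|E x :&: E x0|%:R :> R}].
Proof.
move=> S0 M0 r0 UM EU Er.
have s0 : 0 < #|S|%:R :> R by rewrite ltr0n card_gt0.
pose f u : R := \sum_(x in S) (u \in E x)%:R.
have card_sum (X : {set J}) : X \subset U -> #|X|%:R = \sum_(u in U) (u \in X)%:R :> R.
  move=> XU; rewrite -sumr_const [LHS]big_mkcond [RHS]big_mkcond.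
  by apply: eq_bigr => u _; case: ifP => [/(subsetP XU)->|]; case: (u \in U).
have sum_f : r * M * #|S|%:R <= \sum_(u in U) f u.
  rewrite exchange_big /= mulr_natr -sumr_const; apply: ler_sum => x xS.
  by rewrite -card_sum ?EU ?Er.
have sum_f2 : \sum_(u in U) f u ^+ 2 = \sum_(y in S) \sum_(x in S) #|E x :&: E y|%:R.
  under eq_bigr => u _.
    rewrite expr2 mulr_suml; under eq_bigr do rewrite mulr_sumr. over.
  rewrite exchange_big; apply: eq_bigr => y yS; rewrite exchange_big.
  apply: eq_bigr => x xS /=; rewrite card_sum; last first.
    by apply: subset_trans (EU _ xS); apply: subsetIl.
  by apply: eq_bigr => u _; rewrite inE -natrM mulnb andbC.
have : r ^+ 2 * M * #|S|%:R ^+ 2 <= \sum_(y in S) \sum_(x in S) #|E x :&: E y|%:R.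
  rewrite -sum_f2 -(ler_pM2l M0).
  apply: (@le_trans _ _ ((\sum_(u in U) f u) ^+ 2)).
    have -> : M * (r ^+ 2 * M * #|S|%:R ^+ 2) = (r * M * #|S|%:R) ^+ 2 by ring.
    have rMS : 0 <= r * M * #|S|%:R by rewrite !mulr_ge0 // ltW.
    by rewrite ler_pXn2r // nnegrE // (le_trans rMS).
  apply: le_trans (sqr_sum_le_card _ _) _; rewrite ler_wpM2r //.
  by apply: sumr_ge0 => u _; apply: sqr_ge0.
move=> H; have [x0 x0S Hx0] : exists2 y, y \in S &
    r ^+ 2 * M * #|S|%:R <= \sum_(x in S) #|E x :&: E y|%:R.
  apply/exists_inP; apply: contraT; rewrite negb_exists_in => /forall_inP H'.
  move: H; rewrite expr2 mulrA mulr_natr -sumr_const leNgt ltr_sum //.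
    by case/set0Pn: S0 => y yS; apply/hasP; exists y => //; rewrite mem_index_enum.
  by move=> y /H'; rewrite -ltNge.
pose S' := [set x in S | r ^+ 2 * M <= 2 * #|E x :&: E x0|%:R].
exists x0, S'; split => //; first by apply/subsetP => x; rewrite inE => /andP[].
  have : \sum_(x in S) #|E x :&: E x0|%:R <=
      \sum_(x in S) (M * (x \in S')%:R + r ^+ 2 * M / 2).
    apply: ler_sum => x xS; have rM : 0 <= r ^+ 2 * M by rewrite mulr_ge0 ?sqr_ge0 ?ltW.
    rewrite inE xS /=; case: (leP (r ^+ 2 * M) _) => [_|/ltW]; last by rewrite mulr0 add0r; lra.
    have : #|E x :&: E x0|%:R <= M.
      apply: le_trans UM; rewrite ler_nat; apply/subset_leq_card.
      exact: subset_trans (subsetIl _ _) (EU _ xS).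
    by rewrite mulr1; lra.
  rewrite big_split /= -mulr_sumr sumr_const -[_ *+ #|S|]mulr_natr.
  have -> : \sum_(x in S) (x \in S')%:R = #|S'|%:R :> R.
    rewrite -[RHS]sumr_const [LHS]big_mkcond [RHS]big_mkcond.
    by apply: eq_bigr => x _; rewrite !inE; case: (x \in S) => //=; case: (_ <= _).
  move=> H1; rewrite -(ler_pM2l M0); have := le_trans Hx0 H1.
  set s' := #|S'|%:R; set s := #|S|%:R; lra.
by move=> x; rewrite inE => /andP[].
Qed.

End Pigeonhole.

Section FewGoodDilations.
Import boot.fintype boot.finset.
Variables (R : realFieldType).

(** Sets of small doubling with a large intersection are close to each other: the
    intersection is an intermediate point between them. *)
Lemma ruzsa_intersection (V : finZmodType) (A B : {set V}) (N a b c : R) :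
  0 < N -> 0 < a -> 0 <= b -> N <= a * #|A :&: B|%:R ->
  #|diffset A A|%:R <= b * N -> #|diffset B B|%:R <= c * N ->
  #|diffset A B|%:R <= a * b * c * N.
Proof.
move=> N0 a0 b0 aN bN cN; rewrite -(ler_pM2l N0).
apply: (@le_trans _ _ (a * (#|A :&: B|%:R * #|diffset A B|%:R))).
  by rewrite mulrA ler_wpM2r.
have -> : N * (a * b * c * N) = a * ((b * N) * (c * N)) by ring.
rewrite ler_wpM2l ?(ltW a0) //; apply: (@le_trans _ _ (#|diffset A A|%:R * #|diffset B B|%:R)).
  rewrite -!natrM ler_nat; apply: leq_trans (ruzsa_triangle _ _ _) _.
  by rewrite leq_mul // subset_leq_card // diffsetS // ?subsetIl ?subsetIr.
by rewrite ler_pM.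
Qed.

Lemma diffset_translate (V : finZmodType) (A B : {set V}) c d :
  #|diffset [set a - c | a in A] [set b - d | b in B]| = #|diffset A B|.
Proof.
have -> : diffset [set a - c | a in A] [set b - d | b in B] =
    [set x + (d - c) | x in diffset A B].
  apply/setP => x; apply/imset2P/imsetP.
    move=> [_ _ /imsetP[a aA ->] /imsetP[b bB ->] ->].
    exists (a - b); rewrite ?diffset_f //.
    by rewrite opprB [d - b]addrC addrACA [- c + d]addrC.
  move=> [_ /imset2P[a b aA bB ->] ->].
  exists (a - c) (b - d); first exact: (imset_f (fun a => a - c)).
    exact: (imset_f (fun b => b - d)).
  by rewrite opprB [d - c]addrC [LHS]addrACA [- b + d]addrC.
by rewrite card_imset //; apply: addIr.
Qed.

Lemma dilate_translate (F : finFieldType) (A : {set F}) t c :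
  dilate t [set a - c | a in A] = [set a - t * c | a in dilate t A].
Proof.
by rewrite /dilate -!imset_comp; apply: eq_imset => a /=; rewrite mulrBr.
Qed.

(** The set D given by [balog_szemeredi_gowers] lies in A and in a translate of
    xA, hence D and a translate of x^-1 D both lie in A. *)
Lemma bsg_dilation (F : finFieldType) (A : {set F}) (N K : R) (x : F) :
  0 < N -> 2 <= K -> #|A|%:R <= N -> x != 0 ->
  N ^+ 3 <= K * \sum_c #|fiber A (dilate (- x) A) c|%:R ^+ 2 ->
  exists cD : F * {set F}, [/\ cD.2 \subset A,
    dilate x^-1 [set d - cD.1 | d in cD.2] \subset A,
    N <= K ^+ 4 * #|cD.2|%:R & #|diffset cD.2 cD.2|%:R <= K ^+ 18 * N].
Proof.
move=> N0 K2 AN x0 energy; have K1 : 1 <= K by apply: le_trans K2; rewrite ler1n.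
have cAx : #|dilate (- x) A|%:R <= N by rewrite card_dilate ?oppr_eq0.
have [c [D [DF ND DD]]] := balog_szemeredi_gowers N0 K1 AN cAx energy.
have K0 : 0 <= K by apply: le_trans K1.
have K2n n : 2 ^+ n <= K ^+ n by apply: lerXn2r; rewrite ?nnegrE.
exists (c, D); split => /=.
- by apply: subset_trans DF _; apply/subsetP => a; rewrite inE => /andP[].
- apply/subsetP => _ /imsetP[_ /imsetP[d dD ->] ->].
  move/subsetP/(_ _ dD): DF; rewrite inE => /andP[_ /imsetP[a aA e]].
  by rewrite -opprB e mulNr opprK mulKf.
- apply: (le_trans ND); rewrite ler_wpM2r // exprSr ler_wpM2r //.
  apply: le_trans (K2n 3).
  have -> : (8 : R) = 2 ^+ 3 by ring.
  by [].
- apply: (le_trans DD); rewrite ler_wpM2r ?(ltW N0) // (exprD _ 15 3).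
  rewrite ler_wpM2r ?exprn_ge0 //; apply: le_trans (K2n 15).
  have -> : (8 : R) = 2 ^+ 3 by ring.
  have -> : (64 : R) = 2 ^+ 6 by ring.
  by rewrite -exprM -exprD.
Qed.

(** [popular_intersection] applied to the subsets D x * G x of A * A, where G x is
    the translate of x^-1 (D x) inside A, selects x0 such that for many x
    the set D x meets D x0, and G x meets G x0, in a large set.  Then x^-1 (D x0) is
    close to x^-1 (D x), which up to translation is close to x0^-1 (D x0).  So
    B = D x0 works, with the dilations x / x0. *)
Lemma common_dilation_set (F : finFieldType) (A S : {set F}) (N K : R) :
  0 < N -> 2 <= K -> #|A|%:R <= N -> S != set0 -> 0 \notin S ->
  {in S, forall x, N ^+ 3 <= K * \sum_c #|fiber A (dilate (- x) A) c|%:R ^+ 2} ->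
  exists B T : {set F}, [/\ B \subset A, N <= K ^+ 4 * #|B|%:R, 0 \notin T,
    #|S|%:R <= K ^+ 17 * #|T|%:R & {in T, forall t, tame B (K ^+ 114) t}].
Proof.
move=> N0 K2 AN S0 nS0 energy.
have K1 : 1 <= K by apply: le_trans K2; rewrite ler1n.
have K0 : 0 < K by apply: lt_le_trans K1.
have Sn0 x : x \in S -> x != 0 by apply: contraTneq => ->.
have /choice[cD cDP] : forall x, exists cD : F * {set F}, x \in S ->
  [/\ cD.2 \subset A, dilate x^-1 [set d - cD.1 | d in cD.2] \subset A,
    N <= K ^+ 4 * #|cD.2|%:R & #|diffset cD.2 cD.2|%:R <= K ^+ 18 * N].
  move=> x; have [xS|] := boolP (x \in S); last by exists (0, set0).
  by have [cD ?] := bsg_dilation N0 K2 AN (Sn0 _ xS) (energy _ xS); exists cD.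
pose D x := (cD x).2; pose c x := (cD x).1.
pose G x := dilate x^-1 [set d - c x | d in D x].
have cG x : x \in S -> #|G x| = #|D x|.
  move=> xS; rewrite card_dilate ?invr_eq0 ?Sn0 // card_imset //; exact: addIr.
have GG x y : #|diffset (G x) (G y)| = #|diffset (dilate x^-1 (D x)) (dilate y^-1 (D y))|.
  by rewrite /G !dilate_translate diffset_translate.
have M0 : 0 < N ^+ 2 by rewrite exprn_gt0.
(* D x and G x have at least N / K^4 elements each, and D x * G x lies in a set of
   at most N^2 elements; hence the density K^-8. *)
have [||x||] := @popular_intersection _ _ _ S (setX A A)
    (fun x => setX (D x) (G x)) (N ^+ 2) (K ^- 8) S0 M0.
- by rewrite invr_ge0 exprn_ge0 // ltW.
- by rewrite cardsX natrM expr2 ler_pM.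
- move=> xS; have [DA GA _ _] := cDP _ xS.
  by apply/subsetP => -[a b]; rewrite !inE /= => /andP[/(subsetP DA)-> /(subsetP GA)].
- move=> x xS; have [_ _ ND _] := cDP _ xS.
  rewrite cardsX natrM cG // mulrC ler_pdivrMr ?exprn_gt0 //.
  have -> : #|D x|%:R * #|D x|%:R * K ^+ 8 = (K ^+ 4 * #|D x|%:R) ^+ 2 by ring.
  by rewrite ler_pXn2r // nnegrE ?(ltW N0) // mulr_ge0 ?exprn_ge0 // ltW.
move=> x0 [S' [x0S S'S cS' S'P]].
have [D0A G0A ND0 DD0] := cDP _ x0S; rewrite -/(D x0) in D0A ND0 DD0.
have x0n0 := Sn0 _ x0S.
have K16 : 2 * K ^+ 16 <= K ^+ 17 by rewrite [leRHS]exprS ler_wpM2r // exprn_ge0 // ltW.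
have K8 : (K ^- 8) ^+ 2 = (K ^+ 16)^-1 by rewrite -exprVn -exprM exprVn.
exists (D x0), [set x / x0 | x in S']; split => //.
- apply/imsetP => -[x /(subsetP S'S)/Sn0 xn0] /esym/eqP.
  by rewrite mulf_eq0 invr_eq0 (negbTE xn0) (negbTE x0n0).
- rewrite card_imset; last by apply: mulIf; rewrite invr_eq0.
  move: cS'; rewrite K8 mulrC ler_pdivrMr ?exprn_gt0 // => /le_trans; apply.
  by rewrite mulrAC ler_wpM2r.
move=> _ /imsetP[x xS' ->]; have xS := subsetP S'S _ xS'.
have xn0 := Sn0 _ xS.
have [DA GA ND DD] := cDP _ xS; rewrite -/(D x) in DA ND DD.
have : N ^+ 2 <= K ^+ 17 * (#|D x :&: D x0|%:R * #|G x :&: G x0|%:R).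
  have := S'P _ xS'; rewrite K8 mulrC ler_pdivrMr ?exprn_gt0 // => H.
  apply: (le_trans H); have -> : setX (D x) (G x) :&: setX (D x0) (G x0) =
      setX (D x :&: D x0) (G x :&: G x0).
    by apply/setP => -[a b]; rewrite !inE /= andbACA.
  by rewrite cardsX natrM mulrAC ler_wpM2r // mulr_ge0.
have DN : #|D x :&: D x0|%:R <= N.
  apply: le_trans AN; rewrite ler_nat; apply/subset_leq_card.
  exact: subset_trans (subsetIl _ _) DA.
have GN : #|G x :&: G x0|%:R <= N.
  apply: le_trans AN; rewrite ler_nat; apply/subset_leq_card.
  exact: subset_trans (subsetIl _ _) GA.
move=> DG.
have K17 : 0 < K ^+ 17 by rewrite exprn_gt0.
have K18 : 0 <= K ^+ 18 by rewrite exprn_ge0 // ltW.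
have ND' : N <= K ^+ 17 * #|D x :&: D x0|%:R.
  rewrite -(ler_pM2r N0) -expr2; apply: (le_trans DG).
  by rewrite mulrA ler_wpM2l // mulr_ge0 // ltW.
have NG' : N <= K ^+ 17 * #|G x :&: G x0|%:R.
  rewrite -(ler_pM2r N0) -expr2; apply: (le_trans DG).
  by rewrite [X in _ * X]mulrC mulrA ler_wpM2l // mulr_ge0 // ltW.
have GDD y : y \in S -> #|diffset (G y) (G y)| = #|diffset (D y) (D y)|.
  by move=> yS; rewrite GG -dilate_diffset card_dilate ?invr_eq0 ?Sn0.
have dD := ruzsa_intersection N0 K17 K18 ND' DD DD0.
have dG : #|diffset (G x) (G x0)|%:R <= K ^+ 17 * K ^+ 18 * K ^+ 18 * N.
  by apply: ruzsa_intersection NG' _ _ => //; rewrite GDD.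
rewrite -!exprD !addnE /= in dD dG.
have := ruzsa_triangle (dilate x^-1 (D x)) (dilate x^-1 (D x0)) (dilate x0^-1 (D x0)).
rewrite -GG -dilate_diffset !card_dilate ?invr_eq0 // (card_diffsetC (D x0) (D x)).
rewrite -(ler_nat R) !natrM => /le_trans/(_ (ler_pM (ler0n _ _) (ler0n _ _) dD dG)) H.
have xV : x^-1 != 0 by rewrite invr_eq0.
rewrite /tame -(card_dilate (diffset _ _) xV) dilate_diffset dilateM mulrA mulVf // mul1r.
move: H; set W := #|diffset _ _|%:R => H.
have W0 : 0 <= W :> R by rewrite ler0n.
have K4 : 0 <= K ^+ 4 by rewrite exprn_ge0 // ltW.
have WN : W <= K ^+ 110 * N.
  rewrite -(ler_pM2l N0); apply: (le_trans (ler_wpM2r W0 ND)).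
  rewrite -mulrA; apply: (le_trans (ler_wpM2l K4 H)).
  by apply: eq_ler; ring.
apply: (le_trans WN); rewrite (exprD K 110 4) -mulrA ler_wpM2l //.
by rewrite exprn_ge0 // ltW.
Qed.

(** [sum_product] applied to the sets of [common_dilation_set].  As |A|, |B| and |T|
    agree with N up to powers of K, its three alternatives reduce to two. *)
Lemma energy_dichotomy : exists k : nat, forall (p : nat) (A S : {set 'F_p}) (N K : R),
  prime p -> 0 < N -> 2 <= K -> #|A|%:R <= N -> N <= K * #|S|%:R -> 0 \notin S ->
  {in S, forall x, N ^+ 3 <= K * \sum_c #|fiber A (dilate (- x) A) c|%:R ^+ 2} ->
  N <= K ^+ k \/ p%:R <= K ^+ k * N.
Proof.
pose m := (114 * 34)%N.
exists (m.+1 + 36)%N => p A S N K p_prime N0 K2 AN NS nS0 energy.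
have K1 : 1 <= K by apply: le_trans K2; rewrite ler1n.
have K0 : 0 < K by apply: lt_le_trans K1.
have Kn n : 0 <= K ^+ n by rewrite exprn_ge0 // ltW.
have S0 : S != set0.
  by apply: contraTneq NS => ->; rewrite cards0 mulr0 -ltNge.
have [B [T [BA NB nT0 ST tameT]]] := common_dilation_set N0 K2 AN S0 nS0 energy.
have s0 : 0 < #|S|%:R :> R by rewrite ltr0n card_gt0.
have T0 : T != set0.
  by apply: contraTneq ST => ->; rewrite cards0 mulr0 -ltNge.
have B0 : B != set0.
  by apply: contraTneq NB => ->; rewrite cards0 mulr0 -ltNge.
have BN : #|B|%:R <= N.
  by apply: le_trans AN; rewrite ler_nat subset_leq_card.
have K114 : 1 <= K ^+ 114 by rewrite exprn_ege1.
have := sum_product p_prime T0 nT0 B0 K114 tameT.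
have : 2 * (K ^+ 114) ^+ 34 <= K ^+ m.+1.
  by rewrite -exprM exprS ler_wpM2r.
move: (2 * _) => M MK.
have le_exp i j : (i <= j)%N -> K ^+ i <= K ^+ j by move=> ij; rewrite ler_weXn2l.
case=> H.
- left; apply: (le_trans NB); apply: (@le_trans _ _ (K ^+ 4 * K ^+ m.+1)).
    by rewrite ler_wpM2l // (le_trans H).
  by rewrite -exprD addnC le_exp // leq_add2l.
- right; apply: (le_trans H); apply: ler_pM => //; last first.
    by apply: (le_trans MK); rewrite le_exp // leq_addr.
  by rewrite -(pmulr_lge0 _ (_ : 0 < #|B|%:R)) ?ltr0n ?card_gt0 // (le_trans _ H).
left; rewrite -(ler_pM2r N0) -expr2.
have NT : N <= K ^+ 18 * #|T|%:R.
  by apply: (le_trans NS); rewrite (exprS K 17) -mulrA ler_wpM2l // ltW.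
apply: (@le_trans _ _ ((K ^+ 18 * #|T|%:R) ^+ 2)).
  by rewrite lerXn2r ?nnegrE // ?mulr_ge0 // ltW.
have -> : (K ^+ 18 * #|T|%:R) ^+ 2 = K ^+ 36 * #|T|%:R ^+ 2 by ring.
have -> : K ^+ (m.+1 + 36) * N = K ^+ 36 * (K ^+ m.+1 * N) by rewrite exprD; ring.
rewrite ler_wpM2l //.
apply: (le_trans H); apply: (le_trans (ler_wpM2r _ MK)) => //.
by rewrite ler_wpM2l.
Qed.

End FewGoodDilations.

(** * Energies of probability weights *)

Section WeightedEnergy.
Import boot.fintype boot.finset.
Variables (R : realFieldType) (F : finFieldType).
Implicit Types (f g mu : F -> R) (x c : F).

(** For weights f and g this is the law of U - xV, with U and V independent of
    laws f and g. *)
Definition corr x f g c : R := \sum_v f (c + x * v) * g v.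

Definition energy mu x : R := \sum_c corr x mu mu c ^+ 2.

Definition l2mass mu : R := \sum_u mu u ^+ 2.

Lemma sum_corr x f g : \sum_c corr x f g c = (\sum_u f u) * (\sum_u g u).
Proof.
rewrite exchange_big /= mulr_sumr; apply: eq_bigr => v _.
by rewrite -mulr_suml [in RHS](reindex_inj (addIr (x * v))).
Qed.

Lemma reindex_dilation x c f : x != 0 -> \sum_v f (c + x * v) = \sum_u f u.
Proof.
move=> x0; rewrite [RHS](reindex_inj (inj_comp (addrI c) (mulfI x0))) /=.
by apply: eq_bigr.
Qed.

Lemma corr_ge0 x f g c : (forall u, 0 <= f u) -> (forall u, 0 <= g u) -> 0 <= corr x f g c.
Proof. by move=> f0 g0; apply: sumr_ge0 => v _; rewrite mulr_ge0. Qed.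

Lemma ler_corr x f f' g g' c : (forall u, 0 <= f u) -> (forall u, 0 <= g u) ->
  (forall u, f u <= f' u) -> (forall u, g u <= g' u) ->
  corr x f g c <= corr x f' g' c.
Proof. by move=> f0 g0 ff' gg'; apply: ler_sum => v _; apply: ler_pM. Qed.

Lemma corr_le_l x f g c t : (forall u, 0 <= g u) -> (forall u, f u <= t) ->
  corr x f g c <= t * \sum_u g u.
Proof. by move=> g0 ft; rewrite mulr_sumr; apply: ler_sum => v _; rewrite ler_wpM2r. Qed.

Lemma corr_le_r x f g c t : x != 0 -> (forall u, 0 <= f u) -> (forall u, g u <= t) ->
  corr x f g c <= t * \sum_u f u.
Proof.
move=> x0 f0 gt; rewrite -(reindex_dilation c f x0) mulr_sumr.
by apply: ler_sum => v _; rewrite [leRHS]mulrC ler_wpM2l.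
Qed.

(** The arithmetic-geometric mean inequality, together with the fact that
    v |-> c + xv permutes the field. *)
Lemma corr_le_l2mass x mu c : x != 0 -> corr x mu mu c <= l2mass mu.
Proof.
move=> x0; apply: (@le_trans _ _ (\sum_v ((mu (c + x * v)) ^+ 2 / 2 + mu v ^+ 2 / 2))).
  apply: ler_sum => v _; have := sqr_ge0 (mu (c + x * v) - mu v).
  by rewrite sqrrB; lra.
rewrite big_split /= -!mulr_suml (reindex_dilation c (fun u => mu u ^+ 2) x0).
by rewrite /l2mass; lra.
Qed.

Section Probability.
Variable mu : F -> R.
Hypotheses (mu_ge0 : forall u, 0 <= mu u) (mu_sum1 : \sum_u mu u = 1).
Local Notation delta := (l2mass mu).

Lemma l2mass_gt0 : 0 < delta.
Proof.
rewrite lt_neqAle sumr_ge0 ?andbT; last by move=> u _; apply: sqr_ge0.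
apply/eqP => /esym/eqP; rewrite psumr_eq0 => [|u _]; last exact: sqr_ge0.
move=> /allP mu0; have := @oner_neq0 R; rewrite -mu_sum1 big1 ?eqxx // => u _.
by apply/eqP; rewrite -(sqrf_eq0 (mu u)); apply: mu0; rewrite mem_index_enum.
Qed.

Lemma l2mass_le1 : delta <= 1.
Proof.
rewrite -[X in _ <= X]mu_sum1; apply: ler_sum => u _.
rewrite expr2 ler_piMr //; rewrite -mu_sum1 (bigD1 u) //= lerDl.
by apply: sumr_ge0.
Qed.

Lemma energy_le x : x != 0 -> energy mu x <= delta.
Proof.
move=> x0; apply: (@le_trans _ _ (\sum_c delta * corr x mu mu c)).
  apply: ler_sum => c _; rewrite expr2 ler_wpM2r ?corr_ge0 //.
  exact: corr_le_l2mass.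
by rewrite -mulr_sumr sum_corr mu_sum1 !mulr1.
Qed.

Variable eps : R.
Hypothesis eps_gt0 : 0 < eps.

Definition mid_level : {set F} := [set u | (eps * delta <= mu u) && (eps * mu u <= delta)].

Definition mid_part u : R := if u \in mid_level then mu u else 0.

(** The removed part of mu is at most the sum of a part bounded by eps delta
    pointwise and of a part of mass at most eps (Markov's inequality for mu(X), whose mean is
    delta).  The first makes a correlation pointwise at most eps delta, the second
    makes it of mass at most eps; these are paired with [corr x mu mu], which has
    mass 1 and is pointwise at most delta.  So each of the two parts, removed from
    each of the two arguments, costs at most 2 eps delta in the energy. *)
Lemma energy_mid_part x : x != 0 ->
  energy mu x <= energy mid_part x + 8 * (eps * delta).
Proof.
move=> x0; have d0 := l2mass_gt0.
pose small u := if mu u < eps * delta then mu u else 0.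
pose big u := if delta < eps * mu u then mu u else 0.
pose b u := small u + big u.
have small0 u : 0 <= small u by rewrite /small; case: ifP.
have big0 u : 0 <= big u by rewrite /big; case: ifP.
have small_le u : small u <= eps * delta.
  by rewrite /small; case: ifP => [/ltW//|_]; rewrite mulr_ge0 // ltW.
have big_sum : \sum_u big u <= eps.
  apply: (@le_trans _ _ (\sum_u eps * mu u ^+ 2 / delta)); last first.
    by rewrite -mulr_suml -mulr_sumr mulfK ?gt_eqF.
  apply: ler_sum => u _; rewrite ler_pdivlMr // /big; case: ifP => [h|_].
    by rewrite expr2 mulrCA mulrA -[leRHS]mulrA ler_wpM2l // ltW.
  by rewrite mul0r mulr_ge0 ?sqr_ge0 // ltW.
have small_sum : \sum_u small u <= 1.
  by rewrite -mu_sum1; apply: ler_sum => u _; rewrite /small; case: ifP.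
have mid0 u : 0 <= mid_part u by rewrite /mid_part; case: ifP.
have mid_le u : mid_part u <= mu u by rewrite /mid_part; case: ifP.
have split_mu u : mu u <= mid_part u + b u.
  rewrite /mid_part /b /small /big inE.
  case: (leP (eps * delta)) => /= h1; last by rewrite add0r lerDl; case: ifP.
  case: (leP (eps * mu u)) => /= h2; first by rewrite lerDl addr_ge0 //; case: ifP.
  by rewrite !add0r.
pose h := corr x mu mu; pose hm := corr x mid_part mid_part.
have h_ge0 c : 0 <= h c by apply: corr_ge0.
have hm_ge0 c : 0 <= hm c by apply: corr_ge0.
have hm_le c : hm c <= h c by apply: ler_corr.
have h_sum : \sum_c h c = 1 by rewrite sum_corr mu_sum1 mulr1.
have h_le c : h c <= delta by apply: corr_le_l2mass.
have h_diff c : h c <= hm c + (corr x b mu c + corr x mu b c).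
  rewrite /h /hm /corr -!big_split /=; apply: ler_sum => v _.
  have := split_mu (c + x * v); have := split_mu v.
  have := mid_le (c + x * v); have := mid_le v.
  have := mid0 (c + x * v); have := mid0 v.
  have := mu_ge0 (c + x * v); have := mu_ge0 v.
  have : 0 <= b v by rewrite addr_ge0.
  have : 0 <= b (c + x * v) by rewrite addr_ge0.
  move: (mu _) (mu _) (mid_part _) (mid_part _) (b _) (b _) => m1 m2 g1 g2 b1 b2.
  by move=> *; nra.
have split_l c : corr x b mu c = corr x small mu c + corr x big mu c.
  by rewrite -big_split; apply: eq_bigr => v _; rewrite mulrDl.
have split_r c : corr x mu b c = corr x mu small c + corr x mu big c.
  by rewrite -big_split; apply: eq_bigr => v _; rewrite mulrDr.
have small_l c : corr x small mu c <= eps * delta.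
  by rewrite -[eps * delta]mulr1 -mu_sum1; apply: corr_le_l.
have small_r c : corr x mu small c <= eps * delta.
  by rewrite -[eps * delta]mulr1 -mu_sum1; apply: corr_le_r.
(* h^2 - hm^2 <= 2 h (h - hm), since hm <= h. *)
have step c : h c ^+ 2 <= hm c ^+ 2 +
    (4 * (eps * delta) * h c + 2 * delta * (corr x big mu c + corr x mu big c)).
  have := h_diff c; rewrite split_l split_r.
  have : 0 <= corr x big mu c by apply: corr_ge0.
  have : 0 <= corr x mu big c by apply: corr_ge0.
  have := hm_ge0 c; have := hm_le c; have := h_le c; have := h_ge0 c.
  have := small_l c; have := small_r c.
  move: (h c) (hm c) (corr x small mu c) (corr x mu small c)
    (corr x big mu c) (corr x mu big c).
  move=> H G s1 s2 b1 b2 s2e s1e H0 Hd GH G0 b20 b10 HG.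
  have e1 : H ^+ 2 - G ^+ 2 <= 2 * H * (H - G) by nra.
  have e2 : H * (H - G) <= H * (2 * (eps * delta) + (b1 + b2)) by apply: ler_wpM2l => //; lra.
  have e3 : H * (b1 + b2) <= delta * (b1 + b2) by apply: ler_wpM2r => //; lra.
  by nra.
rewrite /energy; apply: (le_trans (ler_sum _ (fun c _ => step c))).
rewrite !big_split /= lerD2l -!mulr_sumr h_sum big_split /= !sum_corr mu_sum1 mulr1 mul1r.
have := ler_wpM2l (ltW d0) big_sum; lra.
Qed.

Lemma card_mid_level : #|mid_level|%:R <= (eps * delta)^-1.
Proof.
have d0 := l2mass_gt0.
rewrite -[leRHS]mul1r ler_pdivlMr ?mulr_gt0 // -[X in _ <= X]mu_sum1 mulr_natl -sumr_const.
rewrite [leLHS]big_mkcond; apply: ler_sum => u _; rewrite inE.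
by case: ifP => // /andP[].
Qed.

Lemma energy_mid_part_le x : x != 0 -> energy mid_part x <=
  (delta / eps) ^+ 4 * \sum_c #|fiber mid_level (dilate (- x) mid_level) c|%:R ^+ 2.
Proof.
move=> x0; have d0 := l2mass_gt0; rewrite mulr_sumr; apply: ler_sum => c _.
have -> : (delta / eps) ^+ 4 * #|fiber mid_level (dilate (- x) mid_level) c|%:R ^+ 2
  = ((delta / eps) ^+ 2 * #|fiber mid_level (dilate (- x) mid_level) c|%:R) ^+ 2.
  by rewrite [RHS]exprMn -exprM.
have mid0 u : 0 <= mid_part u by rewrite /mid_part; case: ifP.
have de0 : 0 <= delta / eps by rewrite divr_ge0 ?ltW.
apply: lerXn2r; rewrite ?nnegrE ?corr_ge0 ?(mulr_ge0 (exprn_ge0 _ _)) //.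
have -> : #|fiber mid_level (dilate (- x) mid_level) c|%:R =
    \sum_v ((c + x * v \in mid_level) && (v \in mid_level))%:R :> R.
  rewrite -sum_mem -(reindex_dilation c (fun u => (u \in _)%:R) x0).
  apply: eq_bigr => v _; rewrite inE; congr ((_ && _)%:R).
  have -> : c - (c + x * v) = - x * v by rewrite opprD addNKr mulNr.
  by rewrite mem_imset //; apply: mulfI; rewrite oppr_eq0.
rewrite mulr_sumr; apply: ler_sum => v _.
have mid_le u : u \in mid_level -> mu u <= delta / eps.
  by rewrite inE => /andP[_]; rewrite ler_pdivlMr // mulrC.
rewrite /mid_part; case: ifP => [h1|_]; last by rewrite mul0r mulr_ge0 ?exprn_ge0.
case: ifP => [h2|_]; last by rewrite !mulr0.
by rewrite mulr1 expr2; apply: ler_pM; rewrite ?mid_le.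
Qed.

End Probability.
End WeightedEnergy.

Section EnergyBound.
Import boot.fintype boot.finset.
Variable R : realFieldType.

(** With eps = kappa / 32, the part mu cut to [mid_level] keeps at least half
    of the energy of each x in S, where S gathers the x of energy at least half
    the average.  Then [energy_dichotomy] applies with N = 1 / (eps delta) and
    K = eps^-8: the first alternative bounds eps^(8k+1) by delta, the second
    by 1 / (p delta). *)
Lemma average_energy_bound : exists2 k : nat, (0 < k)%N &
  forall (p : nat) (mu : 'F_p -> R) (kappa : R), prime p ->
    (forall u, 0 <= mu u) -> \sum_u mu u = 1 -> 0 < kappa ->
    \sum_(x | x != 0) mu x * energy mu x = kappa * l2mass mu ->
    (kappa / 32) ^+ k <= l2mass mu + (p%:R * l2mass mu)^-1.
Proof.
have [k Hk] := energy_dichotomy R; exists (8 * k).+1 => //.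
move=> p mu kappa p_prime mu0 mu1 kappa0 energy_kappa.
set delta := l2mass mu in energy_kappa *; have d0 : 0 < delta := l2mass_gt0 mu1.
have sub1 (P : pred 'F_p) : \sum_(x | P x) mu x <= 1.
  by rewrite -mu1 [leLHS]big_mkcond; apply: ler_sum => u _; case: ifP.
have kappa1 : kappa <= 1.
  rewrite -(ler_pM2r d0) -energy_kappa.
  apply: (@le_trans _ _ (\sum_(x | x != 0) mu x * delta)).
    by apply: ler_sum => x x0; rewrite ler_wpM2l // energy_le.
  by rewrite -mulr_suml ler_wpM2r // ltW.
pose eps := kappa / 32.
have eps0 : 0 < eps by rewrite divr_gt0.
have kE : kappa = 32 * eps by rewrite /eps; field.
pose A := mid_level mu eps.
(* As kappa = 32 eps, the threshold is half of the average kappa delta. *)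
pose S := [set x | (x != 0) && (16 * (eps * delta) <= energy mu x)].
have muS : 16 * eps <= \sum_(x in S) mu x.
  rewrite -(ler_pM2r d0).
  have : kappa * delta <= (\sum_(x in S) mu x) * delta + 16 * (eps * delta).
    rewrite -energy_kappa; apply: (@le_trans _ _ (\sum_(x | x != 0)
        ((if x \in S then mu x * delta else 0) + mu x * (16 * (eps * delta))))).
      apply: ler_sum => x x0; rewrite inE x0 /=.
      case: (leP (16 * (eps * delta)) (energy mu x)) => [_|/ltW h].
        rewrite -[leLHS]addr0 lerD //; first by rewrite ler_wpM2l // energy_le.
        by rewrite !mulr_ge0 // ltW.
      by rewrite add0r ler_wpM2l.
    rewrite big_split /= lerD // -?mulr_suml.
      rewrite mulr_suml -big_mkcondr /=; apply: eq_ler.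
      by apply: eq_bigl => x; rewrite inE andbA andbb.
    by rewrite ler_piMl // !mulr_ge0 // ltW.
  by rewrite kE; lra.
have cardS : 256 * eps ^+ 2 <= #|S|%:R * delta.
  apply: (@le_trans _ _ ((\sum_(x in S) mu x) ^+ 2)).
    have -> : 256 * eps ^+ 2 = (16 * eps) ^+ 2 by ring.
    have e0 : 0 <= 16 * eps by rewrite mulr_ge0 // ltW.
    by rewrite lerXn2r ?nnegrE // (le_trans e0).
  apply: (le_trans (sqr_sum_le_card _ _)); rewrite ler_wpM2l //.
  rewrite [leLHS]big_mkcond; apply: ler_sum => x _; case: ifP => // _.
  exact: sqr_ge0.
have eps32 : 32 * eps <= 1 by rewrite -kE.
pose N := (eps * delta)^-1; pose K := eps ^- 8.
have N0 : 0 < N by rewrite invr_gt0 mulr_gt0.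
have epsn n : 0 < eps ^+ n by rewrite exprn_gt0.
have eps1 : eps <= 1 by lra.
have epsn1 n : eps ^+ n <= 1 by rewrite exprn_ile1 // ltW.
have K2 : 2 <= K.
  rewrite /K -[leRHS]mul1r ler_pdivlMr // exprS.
  by have := ler_wpM2l (ltW eps0) (epsn1 7%N); lra.
have NS : N <= K * #|S|%:R.
  rewrite -(ler_pM2r d0) -mulrA.
  apply: (@le_trans _ _ (K * (256 * eps ^+ 2))); last by rewrite ler_wpM2l // ltW // invr_gt0.
  have -> : N * delta = K * eps ^+ 7 by rewrite /N /K; field; rewrite !gt_eqF.
  rewrite ler_wpM2l ?ltW ?invr_gt0 //.
  have -> : eps ^+ 7 = eps ^+ 2 * eps ^+ 5 by ring.
  have := ler_wpM2l (ltW (epsn 2%N)) (epsn1 5%N); have := epsn 2%N; lra.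
have nS0 : 0 \notin S by rewrite inE eqxx.
have eS : {in S, forall x, N ^+ 3 <= K * \sum_c #|fiber A (dilate (- x) A) c|%:R ^+ 2}.
  move=> x; rewrite inE => /andP[x0 Ex].
  have := le_trans Ex (energy_mid_part mu0 mu1 eps0 x0).
  have := energy_mid_part_le mu0 mu1 eps0 x0; rewrite -/A -/delta.
  move: (\sum_c _) (energy _ _) => s E0 h1 h2.
  have {h1 h2} h : 8 * (eps * delta) <= (delta / eps) ^+ 4 * s by lra.
  have w0 : 0 < (eps ^+ 3 * delta ^+ 3) * (eps * delta) by rewrite !mulr_gt0 // exprn_gt0.
  rewrite -(ler_pM2r w0).
  have -> : N ^+ 3 * (eps ^+ 3 * delta ^+ 3 * (eps * delta)) = eps * delta.
    by rewrite /N; field; rewrite !gt_eqF.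
  have -> : K * s * (eps ^+ 3 * delta ^+ 3 * (eps * delta)) = (delta / eps) ^+ 4 * s.
    by rewrite /K; field; rewrite !gt_eqF.
  by apply: le_trans h; rewrite ler_peMl ?ler1n // ltW // mulr_gt0.
have AN : #|A|%:R <= N by apply: card_mid_level.
have p0 : 0 < p%:R :> R by rewrite ltr0n prime_gt0.
have V0 : 0 <= (p%:R * delta)^-1 by rewrite invr_ge0 mulr_ge0 // ltW.
have Kk : K ^+ k = (eps ^+ (8 * k))^-1 by rewrite /K exprVn -exprM.
rewrite -/eps; case: (Hk p A S N K p_prime N0 K2 AN NS nS0 eS); rewrite Kk => H.
  apply: (@le_trans _ _ delta); last by rewrite lerDl.
  move: H; rewrite lef_pV2 ?posrE ?mulr_gt0 // exprS => H.
  apply: (@le_trans _ _ (eps ^+ (8 * k))); first by rewrite ler_piMl // ltW.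
  by apply: (le_trans H); rewrite ler_piMl // ltW.
apply: (@le_trans _ _ (p%:R * delta)^-1); last by rewrite lerDr ltW.
rewrite exprS -[leRHS]mul1r ler_pdivlMr ?mulr_gt0 //.
move: H; rewrite /N -invfM -[leRHS]mul1r ler_pdivlMr ?mulr_gt0 //.
by move: (eps ^+ (8 * k)) => e H; apply: le_trans H; apply: eq_ler; ring.
Qed.

End EnergyBound.

(** * Fourier analysis on the prime field *)

Section Fourier.
Variables (R : realType) (p : nat).
Hypothesis p_prime : prime p.
Implicit Types (a b u v x : 'F_p) (f : 'F_p -> R).

Definition angle a : R := 2 * pi * ((a : nat)%:R / p%:R).
Definition cosF a : R := cos (angle a).
Definition sinF a : R := sin (angle a).

Let p_gt0 : 0 < p%:R :> R. Proof. by rewrite ltr0n prime_gt0. Qed.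

Lemma cos_sinDn_2pi (y : R) n :
  cos (y + 2 * pi * n%:R) = cos y /\ sin (y + 2 * pi * n%:R) = sin y.
Proof.
elim: n => [|n [IHc IHs]]; first by rewrite mulr0 addr0.
rewrite -(natr1 n) mulrDr mulr1 addrA.
have -> : 2 * pi = pi *+ 2 :> R by rewrite mulr_natl.
by rewrite cosD2pi sinD2pi -[pi *+ 2]mulr_natl.
Qed.

(** The representative of a + b differs from the sum of the representatives by a
    multiple of p, that is, the angles differ by a multiple of 2 pi. *)
Lemma cos_sinF_add a b : cosF (a + b) = cosF a * cosF b - sinF a * sinF b /\
  sinF (a + b) = sinF a * cosF b + cosF a * sinF b.
Proof.
rewrite /cosF /sinF -cosD -sinD.
have -> : angle a + angle b = angle (a + b) + 2 * pi * ((a + b) %/ p)%N%:R.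
  have : ((a + b)%N%:R : R) = ((a + b) %/ p)%N%:R * p%:R + ((a + b)%R : 'F_p)%:R.
    have -> : nat_of_ord (a + b)%R = ((a + b) %% p)%N.
      exact: (congr1 (modn (nat_of_ord a + nat_of_ord b)) (Fp_cast p_prime)).
    by rewrite -natrM -natrD -divn_eq.
  rewrite natrD => /(canRL (addrK _)) e.
  by rewrite /angle e; field; rewrite gt_eqF.
by have [-> ->] := cos_sinDn_2pi (angle (a + b)) ((a + b) %/ p)%N.
Qed.

Lemma cosF0 : cosF 0 = 1. Proof. by rewrite /cosF /angle mul0r mulr0 cos0. Qed.
Lemma sinF0 : sinF 0 = 0. Proof. by rewrite /sinF /angle mul0r mulr0 sin0. Qed.

Lemma cos_sinF_sqr a : cosF a ^+ 2 + sinF a ^+ 2 = 1.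
Proof. exact: cos2Dsin2. Qed.

Lemma cos_sinF_opp a : cosF (- a) = cosF a /\ sinF (- a) = - sinF a.
Proof.
have [] := cos_sinF_add a (- a); rewrite subrr cosF0 sinF0.
have := cos_sinF_sqr a; move: (cosF a) (sinF a) (cosF (- a)) (sinF (- a)) => c s c' s' h1 h2 h3.
split.
  have -> : c' = c' * (c ^+ 2 + s ^+ 2) by rewrite h1 mulr1.
  have -> : c' * (c ^+ 2 + s ^+ 2) = c * (c * c' - s * s') + s * (s * c' + c * s') by ring.
  by rewrite -h2 -h3; ring.
have -> : s' = s' * (c ^+ 2 + s ^+ 2) by rewrite h1 mulr1.
have -> : s' * (c ^+ 2 + s ^+ 2) = c * (s * c' + c * s') - s * (c * c' - s * s') by ring.
by rewrite -h2 -h3; ring.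
Qed.

(** Through the half angle: cos (2h) = 1 - 2 sin(h)^2 with 0 < h < pi. *)
Lemma cosF_neq1 a : a != 0 -> cosF a != 1.
Proof.
move=> a0; pose h : R := pi * ((a : nat)%:R / p%:R).
have h0 : 0 < sin h.
  apply: sin_gt0_pi; apply/andP; split.
    by rewrite mulr_gt0 ?pi_gt0 // divr_gt0 // ltr0n lt0n.
  rewrite gtr_pMr ?pi_gt0 // ltr_pdivrMr // mul1r ltr_nat.
  by have := ltn_ord a; rewrite [X in (_ < X)%N -> _]Fp_cast.
have -> : cosF a = 1 - 2 * sin h ^+ 2.
  rewrite /cosF; have -> : angle a = h + h by rewrite /angle /h; ring.
  by rewrite cosD -!expr2; have := cos2Dsin2 h; lra.
by rewrite lt_eqF // ltrBlDr ltrDl mulr_gt0 // exprn_gt0.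
Qed.

(** Orthogonality of characters: translating the summation variable by 1 rotates
    the vector (C, S) by the angle of u, so this vector vanishes unless u = 0. *)
Lemma sum_cos_sinF u : \sum_a cosF (a * u) = (if u == 0 then p%:R else 0) /\
  \sum_a sinF (a * u) = 0.
Proof.
have [->|u0] := eqVneq u 0.
  under eq_bigr do rewrite mulr0 cosF0.
  under [X in _ /\ X = _]eq_bigr do rewrite mulr0 sinF0.
  by rewrite sumr_const card_Fp // big1.
set C := \sum_a cosF _; set S := \sum_a sinF _.
have C_shift : C = C * cosF u - S * sinF u.
  rewrite {1}/C (reindex_inj (addIr 1)) /= !mulr_suml -sumrB.
  by apply: eq_bigr => a _; rewrite mulrDl mul1r; case: (cos_sinF_add (a * u) u).
have S_shift : S = S * cosF u + C * sinF u.
  rewrite {1}/S (reindex_inj (addIr 1)) /= !mulr_suml -big_split /=.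
  by apply: eq_bigr => a _; rewrite mulrDl mul1r; case: (cos_sinF_add (a * u) u).
have c1 : cosF u - 1 != 0 by rewrite subr_eq0 cosF_neq1.
have CS : (C ^+ 2 + S ^+ 2) * (cosF u - 1) = 0.
  have e1 : C * (cosF u - 1) = S * sinF u by rewrite mulrBr mulr1 {2}C_shift; ring.
  have e2 : S * (cosF u - 1) = - (C * sinF u) by rewrite mulrBr mulr1 {2}S_shift; ring.
  by rewrite mulrDl !expr2 -!mulrA e1 e2; ring.
move/eqP: CS; rewrite mulf_eq0 (negbTE c1) orbF paddr_eq0 ?sqr_ge0 // !sqrf_eq0.
by case/andP => /eqP -> /eqP ->.
Qed.

Definition cosT f a : R := \sum_u f u * cosF (a * u).
Definition sinT f a : R := \sum_u f u * sinF (a * u).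
(** The squared modulus of the Fourier transform of f. *)
Definition spectrum f a : R := cosT f a ^+ 2 + sinT f a ^+ 2.

Lemma parseval f : \sum_a spectrum f a = p%:R * l2mass f.
Proof.
have specE a : spectrum f a = \sum_u \sum_v f u * f v * cosF (a * (u - v)).
  rewrite /spectrum /cosT /sinT !expr2 !mulr_suml -big_split; apply: eq_bigr => u _ /=.
  rewrite !mulr_sumr -big_split; apply: eq_bigr => v _ /=.
  rewrite mulrBr; have [-> _] := cos_sinF_add (a * u) (- (a * v)).
  by have [-> ->] := cos_sinF_opp (a * v); ring.
under eq_bigr do rewrite specE.
rewrite exchange_big mulr_sumr; apply: eq_bigr => u _ /=.
rewrite exchange_big (bigD1 u) //= [X in _ + X]big1 ?addr0 => [|v vu]; rewrite -mulr_sumr.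
  by have [-> _] := sum_cos_sinF (u - u); rewrite subrr eqxx; ring.
have [-> _] := sum_cos_sinF (u - v).
by rewrite subr_eq0 eq_sym (negbTE vu) mulr0.
Qed.

(** The Fourier transform of [corr x f f] at a is that of f at a times the
    conjugate of that of f at xa. *)
Lemma spectrum_corr f x a : spectrum (corr x f f) a = spectrum f a * spectrum f (x * a).
Proof.
have swap (T : 'F_p -> R) : \sum_c corr x f f c * T (a * c) =
    \sum_v \sum_u f u * f v * T (a * u - x * a * v).
  under eq_bigr do rewrite mulr_suml.
  rewrite exchange_big; apply: eq_bigr => v _ /=.
  rewrite [RHS](reindex_inj (addIr (x * v))); apply: eq_bigr => c _ /=.
  congr (_ * T _); rewrite mulrDr (mulrCA a) mulrA addrK //.
have cE : cosT (corr x f f) a = cosT f a * cosT f (x * a) + sinT f a * sinT f (x * a).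
  rewrite /cosT swap exchange_big /= !mulr_suml -big_split; apply: eq_bigr => u _ /=.
  rewrite !mulr_sumr -big_split; apply: eq_bigr => v _ /=.
  have [-> _] := cos_sinF_add (a * u) (- (x * a * v)).
  by have [-> ->] := cos_sinF_opp (x * a * v); ring.
have sE : sinT (corr x f f) a = sinT f a * cosT f (x * a) - cosT f a * sinT f (x * a).
  rewrite /sinT swap exchange_big /= !mulr_suml -sumrB; apply: eq_bigr => u _ /=.
  rewrite !mulr_sumr -sumrB; apply: eq_bigr => v _ /=.
  have [_ ->] := cos_sinF_add (a * u) (- (x * a * v)).
  by have [-> ->] := cos_sinF_opp (x * a * v); ring.
by rewrite /spectrum cE sE; ring.
Qed.

Lemma sum_spectrum_mul f x :
  \sum_a spectrum f a * spectrum f (x * a) = p%:R * energy f x.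
Proof. by rewrite -[RHS]parseval; apply: eq_bigr => a _; rewrite spectrum_corr. Qed.

Lemma energy0 f : \sum_u f u = 1 -> energy f 0 = l2mass f.
Proof.
move=> f1; apply: eq_bigr => c _; congr (_ ^+ 2); rewrite /corr.
under eq_bigr do rewrite mul0r addr0.
by rewrite -mulr_sumr f1 mulr1.
Qed.

End Fourier.

(** * Expectations of functions of finite-valued variables *)

Local Open Scope classical_set_scope.
Local Open Scope ring_scope.

Section Discrete.
Context d (T : measurableType d) (R : realType) (P : probability T R).

Lemma expectation_finite (I : finType) (Z : T -> I) (g : I -> R) :
  (forall i, measurable (Z @^-1` [set i])) ->
  ('E_P[fun t => g (Z t)] = (\sum_i g i * fine (P (Z @^-1` [set i])))%:E)%E.
Proof.
move=> mZ; rewrite unlock.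
transitivity (\int[P]_t (\sum_i (g i)%:E * (\1_(Z @^-1` [set i]) t)%:E))%E.
  apply: eq_integral => t _.
  rewrite (bigD1 (Z t)) //= big1 ?adde0 => [|i it].
    by rewrite indicE mem_set // mule1.
  by rewrite indicE memNset ?mule0 //= => e; rewrite -e eqxx in it.
have iZ i : P.-integrable [set: T] (fun t => (\1_(Z @^-1` [set i]) t)%:E).
  exact: integrable_indic.
rewrite integral_sum //; last by move=> i; apply: integrableZl.
rewrite -sumEFin; apply: eq_bigr => i _.
rewrite integralZl // integral_indic // setIT EFinM fineK //.
exact: fin_num_measure.
Qed.

Lemma sum_fine_preimage (I : finType) (Z : T -> I) :
  (forall i, measurable (Z @^-1` [set i])) ->
  \sum_i fine (P (Z @^-1` [set i])) = 1 :> R.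
Proof.
move=> mZ; apply: EFin_inj.
have := expectation_finite (fun=> 1) mZ.
rewrite expectation_cst => ->; congr (_%:E).
by under [RHS]eq_bigr do rewrite mul1r.
Qed.

Variable p : nat.

Lemma measurable_Fp (A : set 'F_p) : measurable A.
Proof. by []. Qed.

Lemma measurable_preimage_Fp (Z : {RV P >-> 'F_p}) (A : set 'F_p) :
  measurable (Z @^-1` A).
Proof. exact: measurable_funPTI. Qed.

Lemma normsq_phiE (X : {RV P >-> 'F_p}) a : normsq_phi X a = spectrum (rho X) a.
Proof.
have mX := fun u => measurable_preimage_Fp X [set u].
rewrite /normsq_phi /phi /Cexpectation /e /=.
rewrite (expectation_finite (fun u => cosF R (a * u)) mX).
rewrite (expectation_finite (fun u => sinF R (a * u)) mX).
rewrite /= sqr_sqrtr ?addr_ge0 ?sqr_ge0 //.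
by congr (_ ^+ 2 + _ ^+ 2); apply: eq_bigr => u _; rewrite mulrC.
Qed.

End Discrete.

(** * The laws of the stepping and of the peaking *)

Section SteppingPeaking.
Context d (T : measurableType d) (R : realType) (P : probability T R).
Variable p : nat.
Hypothesis p_prime : prime p.
Variables X X1 X2 Y Yhat : {RV P >-> 'F_p}.
Local Notation mu := (rho X).

Lemma rho_ge0 (Z : {RV P >-> 'F_p}) u : 0 <= rho Z u.
Proof. by rewrite fine_ge0. Qed.

Lemma EFin_rho (Z : {RV P >-> 'F_p}) u : (rho Z u)%:E = P (Z @^-1` [set u]).
Proof. by rewrite fineK // fin_num_measure //; apply: measurable_preimage_Fp. Qed.

Lemma sum_rho (Z : {RV P >-> 'F_p}) : \sum_u rho Z u = 1.
Proof. by apply: sum_fine_preimage => u; apply: measurable_preimage_Fp. Qed.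

Lemma M_l2mass : M X = p%:R * l2mass mu.
Proof. by rewrite -parseval //; apply: eq_bigr => a _; rewrite normsq_phiE. Qed.

Lemma preimage_pair (U V : T -> 'F_p) u v :
  (fun t => (U t, V t)) @^-1` [set (u, v)] = U @^-1` [set u] `&` V @^-1` [set v].
Proof. by apply/seteqP; split => t /= [-> ->]. Qed.

Lemma measurable_preimage_pair (U V : {RV P >-> 'F_p}) w :
  measurable ((fun t => (U t, V t)) @^-1` [set w]).
Proof.
case: w => u v; rewrite preimage_pair.
by apply: measurableI; apply: measurable_preimage_Fp.
Qed.

Lemma expectation_pair (U V : {RV P >-> 'F_p}) (g : 'F_p -> 'F_p -> R) :
  ('E_P[fun t => g (U t) (V t)] = (\sum_u \sum_v
    g u v * fine (P (U @^-1` [set u] `&` V @^-1` [set v])))%:E)%E.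
Proof.
have := expectation_finite P (fun w => g w.1 w.2) (measurable_preimage_pair U V).
move=> /= ->; congr (_%:E); rewrite pair_big; apply: eq_bigr => -[u v] _ /=.
by rewrite preimage_pair.
Qed.

(** Y vanishes when X1 = X2: the collision probability of two independent copies
    of X. *)
Lemma stepping_rho0 : is_stepping X X1 X2 Y -> rho Y 0 = l2mass mu.
Proof.
move=> [indep dX1 dX2 YE].
have rhoE (Z : {RV P >-> 'F_p}) u : distribution P Z = distribution P X ->
    P (Z @^-1` [set u]) = (mu u)%:E.
  by move=> dZ; rewrite EFin_rho -[LHS]/(distribution P Z [set u]) dZ.
have -> : rho Y 0 = fine 'E_P[fun t => (X1 t == X2 t)%:R].
  rewrite /rho -expectation_indic; last exact: measurable_preimage_Fp.
  congr (fine (expectation _ _)); apply/funext => t; rewrite indicE /=.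
  congr (nat_of_bool _)%:R; apply/idP/eqP => [|e].
    by rewrite inE /= YE => /eqP; rewrite subr_eq0 => /eqP.
  by apply/mem_set => /=; rewrite YE e subrr.
rewrite (expectation_pair X1 X2 (fun u v => (u == v)%:R)) /=.
apply: eq_bigr => u _; rewrite (bigD1 u) //= big1 => [|v vu]; last first.
  by rewrite eq_sym (negbTE vu) mul0r.
rewrite eqxx mul1r addr0.
have := indep setT [set u] [set u] measurableT (measurable_Fp _) (measurable_Fp _).
by rewrite preimage_setT setTI => ->; rewrite probability_setT mul1e !rhoE.
Qed.

(** For each x the average over Yhat is sum_a spectrum(a) spectrum(xa) / M, where
    both the sum and M are evaluated by Parseval's identity. *)
Lemma peaking_expectation : is_peaking X X1 X2 Yhat ->
  ('E_P[fun t => (Normc.normc (phi X (X t * Yhat t)) ^+ 2)%R] =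
   (\sum_x mu x * (energy mu x / l2mass mu))%:E)%E.
Proof.
move=> [indep PYhat].
have mu1 : \sum_u mu u = 1 := sum_rho X.
have p0 : p%:R != 0 :> R by rewrite pnatr_eq0 -lt0n prime_gt0.
have d0 : l2mass mu != 0 by rewrite gt_eqF // l2mass_gt0.
transitivity ('E_P[fun t => spectrum mu (X t * Yhat t)%R])%E.
  by congr expectation; apply/funext => t; rewrite -normsq_phiE.
rewrite (expectation_pair X Yhat (fun x a => spectrum mu (x * a))); congr (_%:E).
apply: eq_bigr => x _.
transitivity (\sum_a mu x * (spectrum mu a * spectrum mu (x * a)) / M X).
  apply: eq_bigr => a _; rewrite setIC.
  have mx : measurable ([set x] `*` [set: 'F_p] `*` [set: 'F_p]).
    by apply: measurableX => //; apply: measurableX.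
  have := indep [set a] _ (measurable_Fp _) mx.
  have -> : (fun t => (X t, X1 t, X2 t)) @^-1` ([set x] `*` setT `*` setT) =
      X @^-1` [set x] by apply/seteqP; split => t /= => [[[]]|].
  move=> ->; rewrite PYhat -EFin_rho -EFinM /= normsq_phiE; ring.
rewrite -mulr_suml -mulr_sumr sum_spectrum_mul // M_l2mass.
by field; rewrite p0 d0.
Qed.

End SteppingPeaking.

(** * From the energy estimate to the power saving *)

Section Conclusion.
Variable R : realType.

Lemma powR_root_bound (t delta b : R) (k : nat) : (0 < k)%N ->
  0 <= delta -> 0 <= t -> t ^+ k <= 2 * delta `^ b -> t <= 2 * delta `^ (b / k%:R).
Proof.
move=> k0 d0 t0 H; set s := delta `^ (b / k%:R).
have s0 : 0 <= s by apply: powR_ge0.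
have sk : s ^+ k = delta `^ b.
  by rewrite -powR_mulrn // -powRrM divfK // pnatr_eq0 -lt0n.
rewrite -(@ler_pXn2r _ k) ?nnegrE ?mulr_ge0 //; apply: (le_trans H).
rewrite exprMn sk ler_wpM2r ?powR_ge0 //.
by rewrite -[leLHS]expr1 ler_weXn2l // ler1n.
Qed.

Lemma weighted_energy_bound (eta : R) : 0 < eta ->
  exists2 beta : R, 0 < beta & forall (p : nat) (mu : 'F_p -> R), prime p ->
    (forall u, 0 <= mu u) -> \sum_u mu u = 1 ->
    \sum_x mu x * (energy mu x / l2mass mu) <=
    64 * (mu 0 + l2mass mu `^ beta + p%:R `^ (- 1 + eta) / l2mass mu).
Proof.
move=> eta0; have [k k0 Hk] := average_energy_bound R.
have [b [b0 b1 beta]] : exists b : R, [/\ 0 < b, b <= 1 & b <= eta].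
  by exists (Num.min 1 eta); rewrite lt_min ltr01 eta0 !ge_min !lexx orbT.
exists (b / k%:R); first by rewrite divr_gt0 // ltr0n.
move=> p mu p_prime mu0 mu1; set delta := l2mass mu.
have d0 : 0 < delta by apply: l2mass_gt0.
have d1 : delta <= 1 by apply: l2mass_le1.
have p1 : 1 <= p%:R :> R by rewrite ler1n prime_gt0.
have p0 : 0 < p%:R :> R by apply: lt_le_trans p1.
(* Since delta >= 1 / p, negative powers of p are bounded by powers of delta. *)
have pd : 1 <= p%:R * delta.
  have := @sqr_sum_le_card R _ [set: 'F_p]%SET mu.
  have sumT (f : 'F_p -> R) : \sum_(i in [set: 'F_p]%SET) f i = \sum_i f i.
    by apply: eq_bigl => i; rewrite finset.in_setT.
  by rewrite cardsT card_Fp // !sumT mu1 expr1n.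
set A := delta `^ _; set B := p%:R `^ _ / delta.
have A0 : 0 <= A by apply: powR_ge0.
have B0 : 0 <= B by rewrite divr_ge0 ?powR_ge0 // ltW.
rewrite (bigD1 0) //= energy0 // divff ?gt_eqF // mulr1.
pose kappa := \sum_(x | x != 0) mu x * (energy mu x / delta).
rewrite -/kappa.
suff : kappa <= 64 * (A + B) by have := mu0 0; lra.
have [k_le0|kappa0] := leP kappa 0; first by apply: (le_trans k_le0); rewrite mulr_ge0 ?addr_ge0.
have [pd_lt|pd_ge] := ltP delta (p%:R `^ (- 1 + eta)).
  have B1 : 1 <= B by rewrite ler_pdivlMr // mul1r ltW.
  have : kappa <= 1.
    rewrite -mu1 [leLHS]big_mkcond; apply: ler_sum => x _; case: ifP => // x0.
    by rewrite ler_piMr // ler_pdivrMr // mul1r energy_le.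
  by lra.
have kd : \sum_(x | x != 0) mu x * energy mu x = kappa * delta.
  rewrite mulr_suml; apply: eq_bigr => x _.
  by rewrite -mulrA divfK // gt_eqF.
have := Hk p mu kappa p_prime mu0 mu1 kappa0 kd; rewrite -/delta => H.
have db : delta <= delta `^ b by rewrite ger1_powR // d0.
have pdb : (p%:R * delta)^-1 <= delta `^ b.
  apply: (@le_trans _ _ (p%:R `^ (- b))).
    rewrite powRN lef_pV2 ?posrE ?powR_gt0 ?mulr_gt0 //.
    apply: (@le_trans _ _ (p%:R `^ eta)); first exact: ler_powR.
    apply: (@le_trans _ _ (p%:R * p%:R `^ (- 1 + eta))); last by rewrite ler_wpM2l // ltW.
    have pn0 : p%:R != 0 :> R by rewrite gt_eqF.
    rewrite powRD; last by rewrite pn0 implybT.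
    by rewrite powR_inv1 ?(ltW p0) // mulVKf.
  rewrite -mulN1r powRrM powR_inv1 ?(ltW p0) //; apply: ge0_ler_powR;
    rewrite ?nnegrE ?invr_ge0 ?(ltW b0) ?(ltW p0) ?(ltW d0) //.
  by rewrite -[leLHS]mul1r ler_pdivrMr // mulrC.
have : kappa / 32 <= 2 * A.
  apply: powR_root_bound => //; rewrite ?divr_ge0 ?(ltW d0) ?(ltW kappa0) //.
  by apply: (le_trans H); lra.
by lra.
Qed.

End Conclusion.

Theorem proposition5p1 (R : realType) (eta : R) (eta_gt0 : 0 < eta) :
  exists beta C : R, 0 < beta /\ 0 <= C /\
    forall (p : nat) (p_prime : prime p)
      (d : measure_display) (T : measurableType d) (P : probability T R)
      (X X1 X2 Y Yhat : {RV P >-> 'F_p}),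
      is_stepping X X1 X2 Y ->
      is_peaking X X1 X2 Yhat ->
      ('E_P[fun t => (Normc.normc (phi X (X t * Yhat t)) ^+ 2)%R]
       <= (C * (rho X 0 + rho Y 0 `^ beta
                + p%:R `^ (- 1 + eta) / rho Y 0))%:E)%E.
Proof.
have [beta beta0 bound] := weighted_energy_bound eta_gt0.
exists beta, 64; split => //; split => // p p_prime d T P X X1 X2 Y Yhat stepY peakY.
rewrite (stepping_rho0 stepY) (peaking_expectation p_prime peakY) lee_fin.
exact: bound p_prime (rho_ge0 X) (sum_rho X).
Qed.
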